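(* Let $F$ be a field and let $n\ge 3$ be an integer. Then the group $\mathrm{SL}_n(F)$ is regularly bi-interpretable with the field $F$.
   Context: Groups are structures in the first-order language of groups, fields are structures in the first-order language of rings. Interpretations. Let $\mathcal A,\mathcal B$ be first-order structures. An interpretation code $\Gamma$ (of $\mathcal A$ in $\mathcal B$) consists of first-order formulas in the language of $\mathcal B$, with designated parameter variables $\bar y$: a formula $U(\bar x,\bar y)$ (domain), a formula $E(\bar x,\bar x',\bar y)$ (equality), and one formula for each symbol of the language of $\mathcal A$. If, for a tuple $\bar p$ of $\mathcal B$, $E(\cdot,\cdot,\bar p)$ defines an equivalence relation on the set defined by $U(\cdot,\bar p)$ and the other formulas define on the quotient a structure in the language of $\mathcal A$, this structure is denoted $\Gamma(\mathcal B,\bar p)$. One says that $\mathcal A$ is interpreted in $\mathcal B$ by $\Gamma$ with parameters $\bar p$ if $\mathcal A\cong\Gamma(\mathcal B,\bar p)$. $\mathcal A$ is regularly interpretable in $\mathcal B$, written $\mathcal A\simeq\Gamma(\mathcal B,\varphi)$, if there are a code $\Gamma$ and a formula $\varphi(\bar y)$ in the language of $\mathcal B$, without parameters and satisfied by at least one tuple of $\mathcal B$, such that $\mathcal A\cong\Gamma(\mathcal B,\bar p)$ for every tuple $\bar p$ of $\mathcal B$ with $\mathcal B\models\varphi(\bar p)$. $\mathcal A$ and $\mathcal B$ are regularly bi-interpretable if there are regular interpretations $\mathcal A\simeq\Gamma(\mathcal B,\varphi)$ and $\mathcal B\simeq\Delta(\mathcal A,\psi)$, a formula $\theta_{\mathcal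 A}$ in the language of $\mathcal A$ and a formula $\theta_{\mathcal B}$ in the language of $\mathcal B$ (both without constants) such that: for every $\bar q$ in $\mathcal A$ with $\mathcal A\models\psi(\bar q)$ and every tuple $\bar p$ of elements of $\mathcal A$ representing a tuple of $\Delta(\mathcal A,\bar q)$ that satisfies $\varphi$, the formula $\theta_{\mathcal A}(\cdot,\cdot,\bar p,\bar q)$ defines in $\mathcal A$ an isomorphism from $\mathcal A$ onto $\Gamma(\Delta(\mathcal A,\bar q),\bar p)$; and symmetrically, $\theta_{\mathcal B}$ defines in $\mathcal B$ isomorphisms from $\mathcal B$ onto $\Delta(\Gamma(\mathcal B,\bar p),\bar q)$ for all $\bar p$ satisfying $\varphi$ and all $\bar q$ representing tuples of $\Gamma(\mathcal B,\bar p)$ satisfying $\psi$. *)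

(* Defs.v *)
From HB Require Import structures.
From mathcomp Require Import all_boot all_algebra.
From mathcomp Require Import boolp classical_sets.

Set Implicit Arguments.
Unset Strict Implicit.
Unset Printing Implicit Defensive.

Import GRing.Theory.

Local Open Scope classical_set_scope.

Record signature := Signature {
  fsym : Type;
  farity : fsym -> nat;
  rsym : Type;
  rarity : rsym -> nat }.

Record structure (L : signature) := Structure {
  carrier :> Type;
  fint : forall f : fsym L, ('I_(farity f) -> carrier) -> carrier;
  rint : forall r : rsym L, ('I_(rarity r) -> carrier) -> Prop }.

(* Terms and formulas are indexed by the type V of their free variables;      *)
(* a quantifier binds the variable None of option V. No element of a          *)
(* structure can occur in a formula: parameters are always free variables.    *)
Inductive term (L : signature) (V : Type) : Type :=
| Var of V
| App (f : fsym L) of ('I_(farity f) -> term L V).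

Inductive formula (L : signature) (V : Type) : Type :=
| FFalse
| FEq of term L V & term L V
| FRel (r : rsym L) of ('I_(rarity r) -> term L V)
| FAnd of formula L V & formula L V
| FOr of formula L V & formula L V
| FImp of formula L V & formula L V
| FAll of formula L (option V)
| FEx of formula L (option V).

Fixpoint teval (L : signature) (M : structure L) (V : Type) (v : V -> M)
    (t : term L V) : M :=
  match t with
  | Var x => v x
  | App f ts => fint (fun i => teval v (ts i))
  end.

Definition vcons (V M : Type) (m : M) (v : V -> M) : option V -> M :=
  fun o => if o is Some x then v x else m.

Fixpoint sat (L : signature) (M : structure L) (V : Type) (phi : formula L V)
    (v : V -> M) : Prop :=
  match phi with
  | FFalse => False
  | FEq s t => teval v s = teval v t
  | FRel r ts => rint (fun i => teval v (ts i))
  | FAnd a b => sat a v /\ sat b v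
  | FOr a b => sat a v \/ sat b v
  | FImp a b => sat a v -> sat b v
  | FAll a => forall m : M, sat a (vcons m v)
  | FEx a => exists m : M, sat a (vcons m v)
  end.

Definition isomorphism (L : signature) (A B : structure L) (h : A -> B) : Prop :=
  [/\ bijective h,
      forall (f : fsym L) (xs : 'I_(farity f) -> A),
        h (fint xs) = fint (fun i => h (xs i))
    & forall (r : rsym L) (xs : 'I_(rarity r) -> A),
        rint xs <-> rint (fun i => h (xs i))].

Definition vcat (V W M : Type) (v : V -> M) (w : W -> M) : V + W -> M :=
  fun s => match s with inl x => v x | inr y => w y end.

Definition vflat (I J M : Type) (x : I -> J -> M) : I * J -> M :=
  fun ij => x ij.1 ij.2.

(* A code of LA-structures in LB-structures. A function symbol is interpreted *)
(* by a formula for its graph: arguments, then value, then parameters.        *)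
Record code (LA LB : signature) := Code {
  cdim : nat;
  cpar : nat;
  cU : formula LB ('I_cdim + 'I_cpar);
  cE : formula LB ('I_cdim + 'I_cdim + 'I_cpar);
  cF : forall f : fsym LA,
    formula LB ('I_(farity f) * 'I_cdim + 'I_cdim + 'I_cpar);
  cR : forall r : rsym LA, formula LB ('I_(rarity r) * 'I_cdim + 'I_cpar) }.

Section Interpretation.
Variables (LA LB : signature) (G : code LA LB) (B : structure LB).
Variable p : 'I_(cpar G) -> B.

Local Notation tup := ('I_(cdim G) -> B).

Definition inU (x : tup) : Prop := sat (cU G) (vcat x p).

Definition eqE (x y : tup) : Prop := sat (cE G) (vcat (vcat x y) p).

Definition graphF (f : fsym LA) (xs : 'I_(farity f) -> tup) (y : tup) : Prop :=
  sat (cF G f) (vcat (vcat (vflat xs) y) p).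

Definition holdsR (r : rsym LA) (xs : 'I_(rarity r) -> tup) : Prop :=
  sat (cR G r) (vcat (vflat xs) p).

(* The formulas of G define, with parameters p, an LA-structure on the        *)
(* quotient of U by E.                                                        *)
Record admissible : Prop := Admissible {
  eqE_refl : forall x, inU x -> eqE x x;
  eqE_sym : forall x y, inU x -> inU y -> eqE x y -> eqE y x;
  eqE_trans : forall x y z, inU x -> inU y -> inU z ->
    eqE x y -> eqE y z -> eqE x z;
  graphF_congr : forall (f : fsym LA) (xs xs' : 'I_(farity f) -> tup) y y',
    (forall i, inU (xs i)) -> (forall i, inU (xs' i)) -> inU y -> inU y' ->
    (forall i, eqE (xs i) (xs' i)) -> eqE y y' ->
    graphF xs y -> graphF xs' y';
  graphF_total : forall (f : fsym LA) (xs : 'I_(farity f) -> tup),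
    (forall i, inU (xs i)) -> exists2 y, inU y & graphF xs y;
  graphF_fun : forall (f : fsym LA) (xs : 'I_(farity f) -> tup) y y',
    (forall i, inU (xs i)) -> inU y -> inU y' ->
    graphF xs y -> graphF xs y' -> eqE y y';
  holdsR_congr : forall (r : rsym LA) (xs xs' : 'I_(rarity r) -> tup),
    (forall i, inU (xs i)) -> (forall i, inU (xs' i)) ->
    (forall i, eqE (xs i) (xs' i)) -> holdsR xs -> holdsR xs' }.

Definition is_class (X : set tup) : Prop :=
  exists2 x, inU x & X = [set y | inU y /\ eqE x y].

Definition quot : Type := {X : set tup | is_class X}.

Definition represents (x : tup) (X : quot) : Prop := sval X x.

Definition qgraph (f : fsym LA) (Xs : 'I_(farity f) -> quot) : set tup :=
  [set y | inU y /\
     exists2 xs, (forall i, represents (xs i) (Xs i)) & graphF xs y].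

Hypothesis adm : admissible.

Lemma represents_inU (x : tup) (X : quot) : represents x X -> inU x.
Proof. by rewrite /represents; case: (svalP X) => x0 _ -> []. Qed.

Lemma represents_eqE (x y : tup) (X : quot) :
  represents x X -> represents y X -> eqE x y.
Proof.
rewrite /represents; case: (svalP X) => x0 Ux0 -> [Ux Ex] [Uy Ey].
exact: (eqE_trans adm Ux Ux0 Uy (eqE_sym adm Ux0 Ux Ex) Ey).
Qed.

Lemma represents_ex (X : quot) : exists x, represents x X.
Proof.
rewrite /represents; case: (svalP X) => x Ux ->; exists x.
by split=> //; apply: (eqE_refl adm).
Qed.

Lemma qgraph_class (f : fsym LA) (Xs : 'I_(farity f) -> quot) :
  is_class (qgraph Xs).
Proof.
have [xs xsP] := choice (fun i => represents_ex (Xs i)).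
have Uxs i : inU (xs i) by apply: represents_inU (xsP i).
have [y Uy Gy] := graphF_total adm Uxs.
exists y => //; apply/seteqP; split=> [z [Uz [zs zsP Gz]]|z [Uz Ez]].
  have Uzs i : inU (zs i) by apply: represents_inU (zsP i).
  split=> //; apply: (graphF_fun adm Uxs) => //.
  apply: (graphF_congr adm Uzs Uxs Uz Uz _ (eqE_refl adm Uz) Gz) => i.
  exact: represents_eqE (zsP i) (xsP i).
split=> //; exists xs => //.
by apply: (graphF_congr adm Uxs Uxs Uy Uz _ Ez Gy) => i; apply: (eqE_refl adm).
Qed.

Definition interp : structure LA :=
  @Structure LA quot
    (fun f Xs => exist _ (qgraph Xs) (qgraph_class Xs))
    (fun r Xs => exists2 xs, (forall i, represents (xs i) (Xs i)) & holdsR xs).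

End Interpretation.

Definition interpreted_by (LA LB : signature) (A : structure LA)
    (B : structure LB) (G : code LA LB) (p : 'I_(cpar G) -> B) : Prop :=
  exists (adm : admissible p) (h : A -> interp adm), isomorphism h.

Definition regular_interpretation (LA LB : signature) (A : structure LA)
    (B : structure LB) (G : code LA LB) (phi : formula LB 'I_(cpar G)) : Prop :=
  (exists p : 'I_(cpar G) -> B, sat phi p) /\
  (forall p : 'I_(cpar G) -> B, sat phi p -> interpreted_by A p).

(* theta(x, z, p, q) defines in A an isomorphism from A onto G(D(A, q), p).   *)
(* An element of G(D(A, q), p) is the class of a (cdim G)-tuple w of elements *)
(* of D(A, q), each of which is itself the class of a (cdim D)-tuple of       *)
(* elements of A: z is the resulting tuple of elements of A. Likewise p       *)
(* represents the tuple P of elements of D(A, q).                             *)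
Definition defines_self_isomorphism (LA LB : signature) (A : structure LA)
    (G : code LA LB) (phi : formula LB 'I_(cpar G))
    (D : code LB LA) (psi : formula LA 'I_(cpar D))
    (theta : formula LA (unit + 'I_(cdim G) * 'I_(cdim D)
                         + 'I_(cpar G) * 'I_(cdim D) + 'I_(cpar D))) : Prop :=
  forall q : 'I_(cpar D) -> A, sat psi q ->
  exists admD : admissible q,
  forall (P : 'I_(cpar G) -> interp admD)
         (p : 'I_(cpar G) -> 'I_(cdim D) -> A),
  (forall i, represents (p i) (P i)) -> sat phi P ->
  exists (admG : admissible P) (h : A -> interp admG),
    isomorphism h /\
    forall (x : A) (z : 'I_(cdim G) -> 'I_(cdim D) -> A),
      sat theta
        (vcat (vcat (vcat (fun _ : unit => x) (vflat z)) (vflat p)) q)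
      <-> exists2 w : 'I_(cdim G) -> interp admD,
            forall i, represents (z i) (w i) & represents w (h x).

Definition regularly_biinterpretable (LA LB : signature) (A : structure LA)
    (B : structure LB) : Prop :=
  exists (G : code LA LB) (phi : formula LB 'I_(cpar G))
         (D : code LB LA) (psi : formula LA 'I_(cpar D)),
  [/\ regular_interpretation A B phi,
      regular_interpretation B A psi,
      exists thetaA, @defines_self_isomorphism LA LB A G phi D psi thetaA
    & exists thetaB, @defines_self_isomorphism LB LA B D psi G phi thetaB].

Inductive group_fsym := GMul | GInv | GOne.

Definition group_sig : signature :=
  @Signature group_fsym
    (fun f => match f with GMul => 2 | GInv => 1 | GOne => 0 end)
    void (of_void nat).

Definition group_structure (gT : groupType) : structure group_sig :=
  @Structure group_sig gT
    (fun f => match f return ('I_(@farity group_sig f) -> gT) -> gT with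
      | GMul => fun a => (a ord0 * a ord_max)%g
      | GInv => fun a => (a ord0)^-1%g
      | GOne => fun _ => 1%g
      end)
    (fun r => match r with end).

Inductive ring_fsym := RAdd | ROpp | RMul | RZero | ROne.

Definition ring_sig : signature :=
  @Signature ring_fsym
    (fun f => match f with
      | RAdd | RMul => 2 | ROpp => 1 | RZero | ROne => 0 end)
    void (of_void nat).

Definition ring_structure (R : pzRingType) : structure ring_sig :=
  @Structure ring_sig R
    (fun f => match f return ('I_(@farity ring_sig f) -> R) -> R with
      | RAdd => fun a => (a ord0 + a ord_max)%R
      | ROpp => fun a => (- a ord0)%R
      | RMul => fun a => (a ord0 * a ord_max)%R
      | RZero => fun _ => 0%R
      | ROne => fun _ => 1%R
      end)
    (fun r => match r with end).

Section SpecialLinear.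
Local Open Scope ring_scope.
Variables (n : nat) (F : fieldType).

Record SL : predArgType := MkSL { SLval :> 'M[F]_n; _ : \det SLval == 1 }.

HB.instance Definition _ := [isSub for SLval].
HB.instance Definition _ := [Choice of SL by <:].

Implicit Types A B C : SL.

Lemma SL_det A : \det A = 1.
Proof. by case: A => A /= /eqP. Qed.

Lemma SL_unitmx A : (A : 'M[F]_n) \in unitmx.
Proof. by rewrite unitmxE SL_det unitr1. Qed.

Fact SL_one_subproof : \det (1%:M : 'M[F]_n) == 1.
Proof. by rewrite det1. Qed.

Fact SL_mul_subproof A B : \det (SLval A *m SLval B) == 1.
Proof. by rewrite det_mulmx !SL_det mulr1. Qed.

Fact SL_inv_subproof A : \det (invmx (SLval A)) == 1.
Proof. by rewrite det_inv SL_det invr1. Qed.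

Definition SL_one := MkSL SL_one_subproof.
Definition SL_mul A B := MkSL (SL_mul_subproof A B).
Definition SL_inv A := MkSL (SL_inv_subproof A).

Fact SL_mulA : associative SL_mul.
Proof. by move=> A B C; apply: val_inj; apply: mulmxA. Qed.

Fact SL_mul1 : left_id SL_one SL_mul.
Proof. by move=> A; apply: val_inj; apply: mul1mx. Qed.

Fact SL_mulr1 : right_id SL_one SL_mul.
Proof. by move=> A; apply: val_inj; apply: mulmx1. Qed.

Fact SL_mulV : left_inverse SL_one SL_inv SL_mul.
Proof. by move=> A; apply: val_inj; apply: mulVmx (SL_unitmx A). Qed.

Fact SL_mulrV : right_inverse SL_one SL_inv SL_mul.
Proof. by move=> A; apply: val_inj; apply: mulmxV (SL_unitmx A). Qed.

HB.instance Definition _ :=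
  isGroup.Build SL SL_mulA SL_mul1 SL_mulr1 SL_mulV SL_mulrV.

End SpecialLinear.

(* Main.v *)
From Pilot Require Import Defs.
From mathcomp Require Import all_boot all_algebra.
From mathcomp Require Import boolp classical_sets.

Set Implicit Arguments.
Unset Strict Implicit.
Unset Printing Implicit Defensive.

Import GRing.Theory.
Import Pilot.Defs.

(** Matrices interpret SL_n(F) in F without parameters. Conversely, given the
    tuple of the e_ij(1), the root subgroup {e_02(c)} of SL_n(F) is a copy of F
    whose addition is the product and whose multiplication is a commutator word,
    because [e_ij(a), e_jl(b)] = e_il(ab).

    The point is to choose a formula for the parameters whose solutions are all
    equivalent: then everything checked for the e_ij(1) holds for every solution.
    The formula [frame] says that the q_ij satisfy the Steinberg relations, that
    they are conjugate to each other and nontrivial, that q_01 is unipotent (it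
    has order p in characteristic p, and is conjugate to enough of its powers in
    characteristic 0), and that an element centralizing the first row of the
    frame is central or conjugate to q_01 up to the center. The last condition
    forces q_01 - 1 to have rank one. Indeed, if N^s is the last nonzero power
    of N = q_01 - 1, then 1 + N^s centralizes the first row, so N^s is conjugate
    to N and N has square zero; products of the parts q_0j - 1 vanish, since
    otherwise they would be conjugate to N with a smaller rank; and then
    1 + N E N centralizes the first row for every matrix unit E, so that the
    matrix N E N of rank at most one is zero or conjugate to N
    ([frame_transvection]).

    Transvections satisfying the Steinberg relations are, up to a base change
    and possibly the inverse transpose, the e_ij(1) ([steinberg_conj]): the
    elements of the first row share either their column or their row, and in the
    first case the columns and the rows of the other elements form dual bases.
    Hence a frame is the image of the e_ij(1) under an automorphism of SL_n(F)
    ([frame_automorphism]).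

    The isomorphism from F onto its copy in matrices is c |-> 1 + c(q_02 - 1),
    which is polynomial in c and in the entries of q_02. The isomorphism from
    SL_n(F) onto the matrices over its root subgroup is definable because every
    element is the product of a bounded number of elementary matrices
    ([bounded_generation]): each e_ij(c) is a word in e_02(c) and the frame, and
    so are the copies of the entries of the product ([product_entries]).

    On the side of logic, formulas are replaced by [definable] predicates and
    interpretations by [presents], a bijection onto the domain of a code; this
    notion is carried along isomorphisms, which gives at once the change of
    frame and the composition of the two interpretations. *)

Local Open Scope classical_set_scope.

(** * Definable predicates *)

Section Definable.
Variables (L : signature) (M : structure L).

Definition definable V (P : (V -> M) -> Prop) : Prop :=
  exists phi : formula L V, forall v, sat phi v <-> P v.

Definition term_definable V (f : (V -> M) -> M) : Prop :=
  exists t : term L V, forall v, teval v t = f v.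

Lemma definable_ext V (P Q : (V -> M) -> Prop) :
  (forall v, P v <-> Q v) -> definable P -> definable Q.
Proof. by move=> PQ [phi H]; exists phi => v; rewrite H. Qed.

Lemma term_definable_var V (x : V) : term_definable (fun v => v x).
Proof. by exists (Var L x). Qed.

Lemma term_definable_ext V (f g : (V -> M) -> M) :
  f =1 g -> term_definable f -> term_definable g.
Proof. by move=> fg [t Ht]; exists t => v; rewrite Ht fg. Qed.

Lemma term_definable_weaken V (f : (V -> M) -> M) :
  term_definable f ->
  term_definable (fun w : option V -> M => f (fun x => w (Some x))).
Proof.
move=> [t Ht]; pose ren := fix ren (e : term L V) : term L (option V) :=
  match e with
  | Var x => Var L (Some x)
  | App f ts => App (fun i => ren (ts i))
  end.
exists (ren t) => w; rewrite -Ht; elim: t {Ht} => //= h ts IH.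
by congr fint; apply/funext => i; apply: IH.
Qed.

Lemma definable_eq V (f g : (V -> M) -> M) :
  term_definable f -> term_definable g -> definable (fun v => f v = g v).
Proof. by move=> [s Hs] [t Ht]; exists (FEq s t) => v /=; rewrite Hs Ht. Qed.

Lemma definable_and V (P Q : (V -> M) -> Prop) :
  definable P -> definable Q -> definable (fun v => P v /\ Q v).
Proof. by move=> [a Ha] [b Hb]; exists (FAnd a b) => v /=; rewrite Ha Hb. Qed.

Lemma definable_or V (P Q : (V -> M) -> Prop) :
  definable P -> definable Q -> definable (fun v => P v \/ Q v).
Proof. by move=> [a Ha] [b Hb]; exists (FOr a b) => v /=; rewrite Ha Hb. Qed.

Lemma definable_imp V (P Q : (V -> M) -> Prop) :
  definable P -> definable Q -> definable (fun v => P v -> Q v).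
Proof. by move=> [a Ha] [b Hb]; exists (FImp a b) => v /=; rewrite Ha Hb. Qed.

(** The condition C does not mention the structure, so it may be decided outside
    the logic: the formula depends on whether C holds. *)
Lemma definable_const V (C : Prop) : definable (fun _ : V -> M => C).
Proof.
have [c|nc] := pselect C; last by exists (FFalse L V).
by exists (FImp (FFalse L V) (FFalse L V)) => v /=; split.
Qed.

Lemma definable_not V (P : (V -> M) -> Prop) :
  definable P -> definable (fun v => ~ P v).
Proof. by move=> dP; apply: definable_imp => //; apply: definable_const. Qed.

Lemma definable_all V (Q : M -> (V -> M) -> Prop) :
  definable (fun w : option V -> M => Q (w None) (fun x => w (Some x))) ->
  definable (fun v => forall m, Q m v).
Proof.
by move=> [a Ha]; exists (FAll a) => v; split=> H m; apply/(Ha (vcons m v))/H.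
Qed.

Lemma definable_ex V (Q : M -> (V -> M) -> Prop) :
  definable (fun w : option V -> M => Q (w None) (fun x => w (Some x))) ->
  definable (fun v => exists m, Q m v).
Proof.
by move=> [a Ha]; exists (FEx a) => v; split=> -[m H]; exists m; apply/(Ha (vcons m v)).
Qed.

Lemma definable_forall_fin (I : finType) V (P : I -> (V -> M) -> Prop) :
  (forall i, definable (P i)) -> definable (fun v => forall i, P i v).
Proof.
move=> dP; suff: definable (fun v => forall i, i \in enum I -> P i v).
  by apply: definable_ext => v; split=> H i; [apply: H; rewrite mem_enum|].
elim: (enum I) => [|a s IHs].
  by apply: definable_ext (definable_const _ True) => v; split.
apply: definable_ext (definable_and (dP a) IHs) => v; split.
  by move=> [Ha Hs] i; rewrite in_cons => /orP[/eqP->|/Hs].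
by move=> H; split=> [|i si]; apply: H; rewrite in_cons ?eqxx ?si ?orbT.
Qed.

End Definable.

(** * Presentations of interpreted structures *)

Lemma eq_sat (L : signature) (M : structure L) V (phi : formula L V)
    (v w : V -> M) :
  v =1 w -> sat phi v <-> sat phi w.
Proof. by move=> /funext->. Qed.

Lemma sat_isomorphism (L : signature) (M N : structure L) (h : M -> N) :
  isomorphism h ->
  forall V (phi : formula L V) v, sat phi v <-> sat phi (fun x => h (v x)).
Proof.
move=> [[h' hK h'K] hF hR].
have hT V (t : term L V) v : h (teval v t) = teval (fun x => h (v x)) t.
  elim: t => [x|f ts IH] //=; rewrite hF; congr fint.
  by apply/funext => i; apply: IH.
have hcons V m (v : V -> M) :
    vcons (h m) (fun x => h (v x)) = (fun x => h (vcons m v x)).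
  by apply/funext => -[].
move=> V phi; elim: {V}phi => //= [V s t|V r ts|V a IHa b IHb|V a IHa b IHb
  |V a IHa b IHb|V a IHa|V a IHa] v.
- by rewrite -!hT; split=> [->|/(can_inj hK)].
- by rewrite hR; under [X in rint X]eq_fun do rewrite hT.
- by rewrite IHa IHb.
- by rewrite IHa IHb.
- by rewrite IHa IHb.
- split=> H m; last by apply/IHa; rewrite -hcons.
  by rewrite -(h'K m) hcons; apply/IHa.
- split=> -[m H]; first by exists (h m); rewrite hcons; apply/IHa.
  by exists (h' m); apply/IHa; rewrite -hcons h'K.
Qed.

Lemma isomorphism_comp (L : signature) (A B C : structure L)
    (g : B -> C) (h : A -> B) :
  isomorphism g -> isomorphism h -> isomorphism (fun x => g (h x)).
Proof.
move=> [bg gF gR] [bh hF hR]; split; first exact: (bij_comp bg bh).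
  by move=> f xs; rewrite hF gF.
by move=> r xs; rewrite hR gR.
Qed.

Lemma isomorphism_inv (L : signature) (A B : structure L)
    (h : A -> B) (h' : B -> A) :
  isomorphism h -> cancel h h' -> cancel h' h -> isomorphism h'.
Proof.
move=> [bh hF hR] hK h'K; split; first by exists h.
  move=> f xs; apply: (can_inj hK); rewrite h'K hF; congr fint.
  by apply/funext => i; rewrite h'K.
move=> r xs; rewrite (hR _ (fun i => h' (xs i))).
by under [X in _ <-> rint X]eq_fun do rewrite h'K.
Qed.

Section Presents.
Variables (LA LB : signature) (G : code LA LB).
Implicit Types (A : structure LA) (B : structure LB).

(** An interpretation of A in B given by an explicit bijection from A onto the
    domain of the code, so that the equality of the code is plain equality. *)
Record presents A B (p : 'I_(cpar G) -> B) (iota : A -> 'I_(cdim G) -> B) :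
    Prop := Presents {
  presents_dom : forall x, inU p x <-> exists a, x = iota a;
  presents_eq : forall a b, eqE p (iota a) (iota b) <-> a = b;
  presents_fun : forall (f : fsym LA) (xs : 'I_(farity f) -> A) b,
    graphF p (fun i => iota (xs i)) (iota b) <-> b = fint xs;
  presents_rel : forall (r : rsym LA) (xs : 'I_(rarity r) -> A),
    holdsR p (fun i => iota (xs i)) <-> rint xs }.

Lemma presents_tuple A B (p : 'I_(cpar G) -> B) (iota : A -> 'I_(cdim G) -> B) k
    (xs : 'I_k -> 'I_(cdim G) -> B) :
  presents p iota -> (forall i, inU p (xs i)) ->
  exists as_ : 'I_k -> A, xs = fun i => iota (as_ i).
Proof.
move=> H Uxs.
have [as_ asP] := choice (fun i => (presents_dom H (xs i)).1 (Uxs i)).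
by exists as_; apply/funext.
Qed.

Lemma presents_admissible A B (p : 'I_(cpar G) -> B)
    (iota : A -> 'I_(cdim G) -> B) :
  presents p iota -> admissible p.
Proof.
move=> H; have D x := (presents_dom H x).1.
split.
- by move=> x /D[a ->]; apply/(presents_eq H).
- by move=> x y /D[a ->] /D[b ->] /(presents_eq H)->; apply/(presents_eq H).
- move=> x y z /D[a ->] /D[b ->] /D[c ->].
  by move=> /(presents_eq H)-> /(presents_eq H)->; apply/(presents_eq H).
- move=> f xs xs' y y' /(presents_tuple H)[a ->] /(presents_tuple H)[a' ->].
  move=> /D[b ->] /D[b' ->] Ea /(presents_eq H) Eb.
  have -> : a' = a by apply/funext => i; apply/esym/(presents_eq H).
  by rewrite Eb.
- move=> f xs /(presents_tuple H)[a ->]; exists (iota (fint a)).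
    by apply/(presents_dom H); exists (fint a).
  exact/(presents_fun H).
- move=> f xs y y' /(presents_tuple H)[a ->] /D[b ->] /D[b' ->].
  move=> /(presents_fun H)-> /(presents_fun H)->; exact/(presents_eq H).
- move=> r xs xs' /(presents_tuple H)[a ->] /(presents_tuple H)[a' ->] Ea.
  by have -> : a' = a by apply/funext => i; apply/esym/(presents_eq H).
Qed.

Lemma interp_ext B (p : 'I_(cpar G) -> B) (adm : admissible p)
    (X Y : interp adm) :
  (forall y, represents y X <-> represents y Y) -> X = Y.
Proof.
move=> XY; apply: eq_sig_hprop => [Z cZ cZ'|]; first exact: Prop_irrelevance.
by apply/seteqP; split=> y /XY.
Qed.

(** Equality of the code being equality of the presented elements, the classes
    of the quotient are the singletons {iota a}. *)
Lemma presents_isomorphism A B (p : 'I_(cpar G) -> B)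
    (iota : A -> 'I_(cdim G) -> B) (adm : admissible p) :
  presents p iota ->
  exists h : A -> interp adm, isomorphism h /\
    forall x w, represents w (h x) <-> w = iota x.
Proof.
move=> H.
have cl a : is_class p [set y | inU p y /\ eqE p (iota a) y].
  by exists (iota a) => //; apply/(presents_dom H); exists a.
pose h a : interp adm := exist _ _ (cl a).
have hP x w : represents w (h x) <-> w = iota x.
  rewrite /represents /=; split=> [[/(presents_dom H)[b ->]]|->].
    by move=> /(presents_eq H)->.
  by split; [apply/(presents_dom H); exists x | apply/(presents_eq H)].
have hinj : injective h.
  move=> a b hab; apply/(presents_eq H).
  have /hP -> : represents (iota a) (h b) by rewrite -hab; apply/hP.
  exact/(presents_eq H).
have hrep X : exists a, h a = X.
  have [x Xx] := represents_ex adm X.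
  have [a xa] := (presents_dom H x).1 (represents_inU Xx).
  exists a; apply: interp_ext => y; split; first by move=> /hP->; rewrite -xa.
  move=> Xy; have [b yb] := (presents_dom H y).1 (represents_inU Xy).
  have := represents_eqE adm Xx Xy; rewrite xa yb => /(presents_eq H)->.
  exact/hP.
have [h' h'P] := choice hrep.
exists h; split=> //; split.
- by exists h' => // a; apply: hinj; rewrite h'P.
- move=> f xs; apply: interp_ext => y; split.
    move=> /hP ->; split; first by apply/(presents_dom H); exists (fint xs).
    exists (fun i => iota (xs i)); first by move=> i; apply/hP.
    exact/(presents_fun H).
  move=> [/(presents_dom H)[b ->] [ys ysP]].
  have -> : ys = fun i => iota (xs i) by apply/funext => i; apply/hP.
  by move=> /(presents_fun H)->; apply/hP.
- move=> r xs; split=> [xsr|[ys ysP]].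
    exists (fun i => iota (xs i)); first by move=> i; apply/hP.
    exact/(presents_rel H).
  have -> : ys = fun i => iota (xs i) by apply/funext => i; apply/hP.
  by move=> /(presents_rel H).
Qed.

(** Satisfaction of the formulas of the code is invariant under h. *)
Lemma presents_transport A B B' (h : B -> B') (p : 'I_(cpar G) -> B)
    (iota : A -> 'I_(cdim G) -> B) :
  isomorphism h -> presents p iota ->
  presents (fun j => h (p j)) (fun a i => h (iota a i)).
Proof.
move=> ih H; have [[h' hK h'K] _ _] := ih.
have Hsat V W (phi : formula LB (V + W)) v w :
    sat phi (vcat v w) <-> sat phi (vcat (fun x => h (v x)) (fun x => h (w x))).
  rewrite (sat_isomorphism ih); apply: eq_sat; by case.
have Hsat3 V W Z (phi : formula LB (V + W + Z)) v w z :
    sat phi (vcat (vcat v w) z) <->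
    sat phi (vcat (vcat (fun x => h (v x)) (fun x => h (w x)))
                  (fun x => h (z x))).
  by rewrite (sat_isomorphism ih); apply: eq_sat => -[[]|].
split.
- move=> x; have -> : x = fun i => h (h' (x i)).
    by apply/funext => i; rewrite h'K.
  rewrite /inU -Hsat; split.
    by move=> /(presents_dom H)[a xa]; exists a; rewrite -xa.
  move=> [a xa]; apply/(presents_dom H); exists a; apply/funext => i.
  by apply: (can_inj hK); rewrite (congr1 (@^~ i) xa).
- by move=> a b; rewrite /eqE -Hsat3; apply: (presents_eq H).
- by move=> f xs b; rewrite -(presents_fun H) /graphF Hsat3.
- by move=> r xs; rewrite -(presents_rel H) /holdsR Hsat.
Qed.

Lemma presents_precomp A A' B (h : A' -> A) (p : 'I_(cpar G) -> B)
    (iota : A -> 'I_(cdim G) -> B) :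
  isomorphism h -> presents p iota -> presents p (fun a => iota (h a)).
Proof.
move=> [[h' hK h'K] hF hR] H; split.
- move=> x; rewrite (presents_dom H); split=> -[a ->]; last by exists (h a).
  by exists (h' a); rewrite h'K.
- by move=> a b; rewrite (presents_eq H); split=> [/(can_inj hK)|->].
- by move=> f xs b; rewrite (presents_fun H) -hF; split=> [/(can_inj hK)|->].
- by move=> r xs; rewrite (presents_rel H) -hR.
Qed.

Lemma presents_interpreted A B (p : 'I_(cpar G) -> B)
    (iota : A -> 'I_(cdim G) -> B) :
  presents p iota -> interpreted_by A p.
Proof.
move=> H; exists (presents_admissible H).
by have [h [hi _]] := presents_isomorphism (presents_admissible H) H; exists h.
Qed.

End Presents.

(** Inside D(A, q), which is a copy of B, the code G is presented by the
    transport of its presentation over B, so that an element of G(D(A, q), p)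
    has a single representative, computed by composing presentations. *)
Lemma presents_self_isomorphism (LA LB : signature) (A : structure LA)
    (B : structure LB) (G : code LA LB) (phi : formula LB 'I_(cpar G))
    (D : code LB LA) (psi : formula LA 'I_(cpar D)) theta :
  (forall q : 'I_(cpar D) -> A, sat psi q ->
     exists2 iD : B -> 'I_(cdim D) -> A, presents q iD &
     forall p : 'I_(cpar G) -> B, sat phi p ->
     exists2 iG : A -> 'I_(cdim G) -> B, presents p iG &
     forall x z,
       sat theta (vcat (vcat (vcat (fun _ : unit => x) (vflat z))
                             (vflat (fun k => iD (p k)))) q)
       <-> z = fun i => iD (iG x i)) ->
  @defines_self_isomorphism LA LB A G phi D psi theta.
Proof.
move=> H q /H [iD HD {}H].
have admD := presents_admissible HD; exists admD => P p pP phiP.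
have [h [hi hP]] := presents_isomorphism admD HD.
have [[h' hK h'K] _ _] := hi.
pose p0 k := h' (P k).
have P_E : P = fun k => h (p0 k) by apply/funext => k; rewrite h'K.
have pE : p = fun k => iD (p0 k) by apply/funext => k; apply/hP; rewrite h'K.
have /H [iG HG HT] : sat phi p0 by apply/(sat_isomorphism hi); rewrite -P_E.
have HG' := presents_transport hi HG; rewrite -P_E in HG'.
have admG := presents_admissible HG'; exists admG.
have [k [ki kP]] := presents_isomorphism admG HG'.
exists k; split=> // x z; rewrite pE HT; split.
  move=> ->; exists (fun i => h (iG x i)); last exact/kP.
  by move=> i; apply/hP.
by move=> [w zw /kP wE]; apply/funext => i; apply/hP; move: (zw i); rewrite wE.
Qed.

(** * Codes built from definable predicates *)

Section DefinableCode.
Variables (LA LB : signature) (B : structure LB) (d m : nat).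
Variables (U : ('I_d + 'I_m -> B) -> Prop) (dU : definable U).
Variables (gr : forall f : fsym LA,
  ('I_(farity f) * 'I_d + 'I_d + 'I_m -> B) -> Prop).
Hypothesis dgr : forall f, definable (@gr f).
Hypothesis noR : rsym LA -> False.

Lemma definable_tuple_eq :
  definable (fun v : 'I_d + 'I_d + 'I_m -> B =>
    forall i, v (inl (inl i)) = v (inl (inr i))).
Proof.
by apply: definable_forall_fin => i; apply: definable_eq;
  apply: term_definable_var.
Qed.

Definition definable_code : code LA LB :=
  Code (sval (cid dU)) (sval (cid definable_tuple_eq))
       (fun f => sval (cid (dgr f))) (fun r => match noR r with end).

Lemma definable_code_presents (A : structure LA)
    (p : 'I_(cpar definable_code) -> B)
    (iota : A -> 'I_(cdim definable_code) -> B) :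
  injective iota ->
  (forall x, U (vcat x p) <-> exists a, x = iota a) ->
  (forall (f : fsym LA) (xs : 'I_(farity f) -> A) b,
     gr (vcat (vcat (vflat (fun i => iota (xs i))) (iota b)) p) <->
     b = fint xs) ->
  presents p iota.
Proof.
move=> iI HU HF; split.
- by move=> x; rewrite -HU /inU /=; case: cid => phi /= ->.
- move=> a b; rewrite /eqE /=; case: cid => phi /= ->; split=> [|-> //].
  by move=> /funext /iI.
- by move=> f xs b; rewrite -HF /graphF /=; case: cid => phi /= ->.
- by move=> r; case: (noR r).
Qed.

End DefinableCode.

Local Open Scope ring_scope.

(** * Nilpotent and unipotent matrices *)

Section Nilpotent.
Variable F : fieldType.

(** det(1 + XN) is a unit of F[X], with inverse det(1 - XN), hence is constant:
    its values at 1 and at 0 agree. *)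
Lemma det_add_sqzero n (N : 'M[F]_n) : N *m N = 0 -> \det (1%:M + N) = 1.
Proof.
move=> N2; pose NX : 'M[{poly F}]_n := 'X *: map_mx polyC N.
have NX2 : NX *m NX = 0.
  by rewrite -scalemxAl -scalemxAr -map_mxM N2 map_mx0 !scaler0.
have : \det (1%:M + NX) * \det (1%:M - NX) = 1.
  rewrite -det_mulmx mulmxBr mulmx1 mulmxDl NX2 addr0 mul1mx.
  by rewrite addrK det1.
move=> /(congr1 (fun p : {poly F} => p \is a GRing.unit)).
rewrite unitr1 unitrM => /andP[]; rewrite poly_unitE => /andP[/size_poly1P].
move=> [c _ dc] _ _.
have ev t : \det (1%:M + t *: N) = (\det (1%:M + NX)).[t].
  have -> : 1%:M + t *: N = map_mx (horner_eval t) (1%:M + NX).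
    by apply/matrixP=> i j; rewrite !mxE /horner_eval !hornerE; case: eqP;
      rewrite ?hornerE.
  by rewrite det_map_mx.
rewrite -[X in _ + X](scale1r) ev dc hornerC -(hornerC c 0) -dc -ev.
by rewrite scale0r addr0 det1.
Qed.

(** Writing e = CR with C of full column rank and R of full row rank, e^2 = e
    gives RC = 1, and tr(CR) = tr(RC). *)
Lemma idempotent_trace n (e : 'M[F]_n) : e *m e = e -> \tr e = (\rank e)%:R.
Proof.
move=> ee; rewrite -[in LHS](mulmx_base e) mxtrace_mulC.
suff -> : row_base e *m col_base e = 1%:M by rewrite mxtrace1.
apply: (row_full_inj (col_base_full e)); rewrite /= mulmx1.
apply: (row_free_inj (row_base_free e)); rewrite /= mulmxA.
by rewrite -mulmxA !mulmx_base.
Qed.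

(** Let y = a(a - 1). By Cayley-Hamilton the hypothesis gives tr(g(a)y) = 0 for
    every polynomial g. If X^s h is the characteristic polynomial of y, with
    h(0) nonzero, a Bezout relation between X^(s+1) and h yields an idempotent
    e, multiple of y^(s+1), with y^(s+1) = y^(s+1) e. Its trace is zero, and is
    the image of its rank in F, which has characteristic 0; hence e = 0 and y is
    nilpotent, and so is a - 1 since a is invertible. *)
Lemma trace_nilpotent n (a : 'M[F]_n.+1) :
  [pchar F] =i pred0 -> a \is a GRing.unit ->
  (forall k, (k <= n)%N -> \tr (a ^+ k.+2) = \tr a) ->
  exists k, (a - 1) ^+ k = 0.
Proof.
move=> ch0 ua tra.
have tra' k : (k <= n.+1)%N -> \tr (a ^+ k.+1) = \tr a.
  by case: k => // k; apply: tra.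
pose y := a * (a - 1).
have try g : \tr (horner_mx a g * y) = 0.
  have -> : horner_mx a g = horner_mx a (g %% char_poly a).
    by rewrite {1}(divp_eq g (char_poly a)) rmorphD rmorphM /= Cayley_Hamilton
      mulr0 add0r.
  set r := g %% _; have sr : (size r <= n.+1)%N.
    by rewrite -ltnS -(size_char_poly a) ltn_modp -size_poly_eq0 size_char_poly.
  rewrite -[r]coefK poly_def !linear_sum /= mulr_suml linear_sum big1 //= => i _.
  rewrite linearZ /= rmorphXn /= horner_mx_X -scalerAl linearZ /=.
  rewrite /y mulrA -exprSr mulrBr mulr1 -exprSr linearB /=.
  have ni : (i <= n)%N by rewrite -ltnS (leq_trans (ltn_ord i) sr).
  by rewrite !tra' ?subrr ?mulr0 // ltnW.
have [s [h hr hE]] := multiplicity_XsubC (char_poly y) 0.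
rewrite -size_poly_eq0 size_char_poly /= subr0 in hr hE.
have cop : coprimep ('X ^+ s.+1) h.
  by rewrite coprimep_expl // coprimep_sym -['X]subr0 -polyC0 coprimep_XsubC.
have /Bezout_eq1_coprimepP [[u v] /= uv] := cop.
pose e := horner_mx y (u * 'X ^+ s.+1).
have e1 : 1 - e = horner_mx y (v * h).
  by rewrite /e -[1](rmorph1 (horner_mx y)) -uv rmorphD /= addrC addrA addNr add0r.
have ye : y ^+ s.+1 * (1 - e) = 0.
  rewrite e1 -{1}(horner_mx_X y) -rmorphXn -rmorphM /=.
  rewrite mulrCA exprS -mulrA ['X ^+ s * h]mulrC -hE mulrA rmorphM /=.
  by rewrite Cayley_Hamilton mulr0.
have ee : e * e = e.
  apply/esym/eqP; rewrite -subr_eq0 -{1}[e]mulr1 -mulrBr.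
  have {1}-> : e = horner_mx y u * y ^+ s.+1.
    by rewrite /e rmorphM rmorphXn /= horner_mx_X.
  by rewrite -mulrA ye mulr0.
have te : \tr e = 0.
  pose Y : {poly F} := 'X * ('X - 1).
  have yE : y = horner_mx a Y by rewrite rmorphM rmorphB /= horner_mx_X rmorph1.
  have -> : e = horner_mx a ((u * 'X ^+ s) \Po Y) * y.
    rewrite /e exprSr mulrA rmorphM /= horner_mx_X; congr (_ * _).
    elim/poly_ind: (u * 'X ^+ s) => [|p c IH].
      by rewrite comp_poly0 !rmorph0.
    rewrite comp_polyD comp_polyM comp_polyX comp_polyC !rmorphD.
    rewrite rmorphM [RHS](congr1 (+%R^~ _) (rmorphM _ _ _)) /= -IH -yE.
    by rewrite horner_mx_X !horner_mx_C.
  exact: try.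
have e0 : e = 0.
  apply/eqP; rewrite -mxrank_eq0.
  have := idempotent_trace ee; rewrite te => /esym/eqP.
  by rewrite (iffLR (pcharf0P F) ch0).
exists s.+1; move: ye; rewrite e0 subr0 mulr1 exprMn_comm; last first.
  by apply: commrB; [apply: commr_refl | apply: commr1].
by move=> /(congr1 (fun x => a ^- s.+1 * x)); rewrite mulKr ?mulr0 // unitrX.
Qed.

Lemma pchar_nilpotent n p (a : 'M[F]_n.+1) :
  p \in [pchar F] -> a ^+ p = 1 -> (a - 1) ^+ p = 0.
Proof.
move=> pF ap; have pM : p \in [pchar 'M[F]_n.+1].
  by rewrite (rmorph_pchar (@scalar_mx F n.+1)).
have := pFrobenius_autB_comm pM (commr1 a).
by rewrite !pFrobenius_autE ap expr1n subrr.
Qed.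

End Nilpotent.

(** * Square-zero matrices of rank one *)

Section Transvections.
Variable F : fieldType.

Lemma nilpotent_sqzero_power (R : nzRingType) (x : R) k :
  x ^+ k = 0 -> x != 0 ->
  exists s, [/\ x ^+ s.+1 != 0 & x ^+ s.+1 * x ^+ s.+1 = 0].
Proof.
move=> xk x0; have ex : exists k, x ^+ k == 0 by exists k; rewrite xk.
case: (ex_minnP ex) => -[|[|s]] /eqP xs min.
- by move: xs => /eqP; rewrite expr0 oner_eq0.
- by move: x0; rewrite -[x]expr1 xs eqxx.
exists s; split; first by apply/negP => /min; rewrite ltnn.
by rewrite -exprD addSnnS addnC exprD xs mul0r.
Qed.

Lemma nilpotent_det0 n (X : 'M[F]_n.+1) k : X ^+ k = 0 -> \det X = 0.
Proof.
move=> Xk; have : \det (X ^+ k) = 0 by rewrite Xk det0.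
move=> /eqP; elim: k {Xk} => [|i IH]; first by rewrite expr0 det1 oner_eq0.
by rewrite exprS -mulmxE det_mulmx mulf_eq0 => /orP[/eqP|/IH].
Qed.

(** The map g sends a row killed by X to an eigenvector of N of eigenvalue
    z^-1 - 1, which has to be 0. *)
Lemma scalar_conj_nilpotent n (N X g : 'M[F]_n.+1) (z : F) k l :
  N ^+ k = 0 -> X ^+ l = 0 -> g \is a GRing.unit ->
  (1 + X) * g = z *: (g * (1 + N)) -> X * g = g * N.
Proof.
move=> Nk /nilpotent_det0 X0 ug; rewrite mulrDl mulrDr mul1r mulr1 => E.
suff z1 : z = 1 by move: E; rewrite z1 scale1r => /addrI.
have /eqP/det0P [w w0 wX] := X0.
pose r := w *m g; have r0 : r != 0.
  apply: contraNneq w0 => r0; have := mulmxK ug w; rewrite -/r r0 mul0mx => <-.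
  by [].
have rN : z *: (r *m N) = (1 - z) *: r.
  have := congr1 (mulmx w) E; rewrite mulmxDr -scalemxAr mulmxDr !mulmxA wX mul0mx.
  rewrite addr0 -/r scalerDr => rE; apply/eqP.
  by rewrite scalerBl scale1r eq_sym subr_eq addrC -rE.
have rNi i : z ^+ i *: (r *m N ^+ i) = (1 - z) ^+ i *: r.
  elim: i => [|i IH]; first by rewrite !expr0 !scale1r mulmx1.
  rewrite [N ^+ _]exprSr -[N ^+ i * N]/(N ^+ i *m N) mulmxA.
  rewrite exprS -scalerA scalemxAl IH -scalemxAl.
  by rewrite scalerA mulrC -scalerA rN scalerA -exprSr.
have /eqP := rNi k; rewrite Nk mulmx0 scaler0 eq_sym scaler_eq0 (negPf r0) orbF.
by rewrite expf_eq0 subr_eq0 => /andP[_ /eqP].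
Qed.

(** If N_s N_t is nonzero, it has the same rank as N_t and therefore the same
    row space, so that N_t = X N_s N_t; but then
    N_t N_s = X N_s^2 N_t = 0. *)
Lemma sqzero_annihilate (I : Type) n (N : I -> 'M[F]_n.+1) :
  (forall s t, N s * N t = N t * N s) -> (forall s, N s * N s = 0) ->
  (forall s X, X * X = 0 -> X != 0 -> (forall t, X * N t = N t * X) ->
     \rank X = \rank (N s)) ->
  forall s t, N s * N t = 0.
Proof.
move=> NC N2 Nr s t; apply/eqP/negPn/negP => P0.
have P2 : N s * N t * (N s * N t) = 0.
  by rewrite mulrA -[_ * N s]mulrA [N t * _]NC !mulrA N2 !mul0r.
have PC r : N s * N t * N r = N r * (N s * N t).
  by rewrite -mulrA [N t * _]NC mulrA [N s * _]NC mulrA.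
have /mxrank_leqif_sup/eq_leqif : (N s *m N t <= N t)%MS by apply: submxMl.
rewrite mulmxE (Nr t) // eqxx => /esym/submxP [X NtE].
move: P0; rewrite NC {1}NtE mulmxE -mulrA -[_ * N s]mulrA [N t * _]NC.
by rewrite [N s * (N s * _)]mulrA N2 mul0r mulr0 eqxx.
Qed.

(** The matrix N_s E N_s, for a matrix unit E, has rank at most one and its
    products with every N_t vanish; E is chosen so that it is nonzero. *)
Lemma rank_one_of_sqzero (I : Type) n (N : I -> 'M[F]_n.+1) s :
  (forall s t, N s * N t = N t * N s) -> (forall s, N s * N s = 0) ->
  (forall s X, X * X = 0 -> X != 0 -> (forall t, X * N t = N t * X) ->
     \rank X = \rank (N s)) ->
  N s != 0 -> \rank (N s) = 1%N.
Proof.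
move=> NC N2 Nr N0; have NN := sqzero_annihilate NC N2 Nr.
have [a [k ak]] : exists a k, N s a k != 0.
  apply: contrapT => H; move/eqP: N0; apply; apply/matrixP => a k.
  by rewrite mxE; apply/eqP/negPn/negP => ?; apply: H; exists a, k.
pose L : 'M_n.+1 := N s *m delta_mx k a *m N s.
have L0 : L != 0.
  apply/eqP => /matrixP/(_ a k); rewrite !mxE (bigD1 a) //= big1 ?addr0.
    rewrite !mxE (bigD1 k) //= big1 ?addr0 => [|j /negPf jk]; rewrite !mxE.
      by rewrite !eqxx mulr1 => /eqP; rewrite mulf_eq0 orbb (negPf ak).
    by rewrite jk mulr0.
  move=> b /negPf ba; rewrite !mxE big1 ?mul0r // => j _; rewrite !mxE ba.
  by rewrite andbF mulr0.
apply/eqP; rewrite eqn_leq lt0n mxrank_eq0 N0 andbT.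
rewrite -(Nr s L) //.
- apply: leq_trans (mxrankM_maxl _ _) _; apply: leq_trans (mxrankM_maxr _ _) _.
  by rewrite mxrank_delta.
- by rewrite /L !mulmxE !mulrA -[_ * N s * N s]mulrA N2 mulr0 !mul0r.
- by move=> t; rewrite /L !mulmxE -mulrA NN mulr0 !mulrA NN !mul0r.
Qed.

Lemma rank1_dyad m n (A : 'M[F]_(m, n)) :
  \rank A = 1%N -> exists (u : 'cV_m) (f : 'rV_n), A = u *m f.
Proof.
move=> r1; have := mulmx_base A; move: (col_base A) (row_base A).
by rewrite r1 => u f <-; exists u, f.
Qed.

Lemma row_of_unitmx n (v : 'rV[F]_n.+1) :
  v != 0 -> exists2 Q : 'M_n.+1, Q \in unitmx & v = delta_mx 0 0 *m Q.
Proof.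
move=> v0; have rv : \rank v = 1%N.
  by apply/eqP; rewrite eqn_leq rank_leq_row lt0n mxrank_eq0.
have := mulmx_ebase v; have := col_ebase_unit v; have := row_ebase_unit v.
rewrite rv; move: (col_ebase v) (row_ebase v) => C R uR.
rewrite [C]mx11_scalar unitmxE det_scalar1 unitfE => c0 <-.
exists (C 0 0 *: R); first by rewrite unitmxZ ?unitfE.
rewrite -scalemxAr mul_scalar_mx -scalemxAl; congr (_ *: (_ *m _)).
by apply/matrixP => i j; rewrite !mxE !ord1; case: j => -[|j] //=.
Qed.

(** A base change sends the column of N to the first basis vector, and a second
    one, fixing this vector, sends its row to the second coordinate form. The
    determinant is corrected on the third basis vector, which the matrix unit
    does not involve. *)
Lemma sqzero_rank1_conj k (N : 'M[F]_k.+3) :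
  \rank N = 1%N -> N *m N = 0 ->
  exists2 g : 'M_k.+3, \det g = 1 & g *m N = delta_mx 0 1 *m g.
Proof.
move=> rN N2; have [u [f NE]] := rank1_dyad rN.
have [u0 f0] : u != 0 /\ f != 0.
  by split; apply/eqP => E; move: rN; rewrite NE E ?mul0mx ?mulmx0 mxrank0.
have fu : f *m u = 0.
  apply/eqP; rewrite [_ *m _]mx11_scalar; set c := (f *m u) 0 0.
  have : c *: N = 0.
    rewrite -N2 NE mulmxA -[u *m f *m u]mulmxA [f *m u]mx11_scalar -/c.
    by rewrite mul_mx_scalar scalemxAl.
  move=> /eqP; rewrite scaler_eq0 => /orP[/eqP->|/eqP N0]; first by rewrite raddf0.
  by move: rN; rewrite N0 mxrank0.
have [Q Qu uE] : exists2 Q : 'M_k.+3, Q \in unitmx & u = Q *m delta_mx 0 0.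
  have [|Q Qu E] := row_of_unitmx (v := u^T); first by rewrite -trmx0 (inj_eq trmx_inj).
  exists Q^T; rewrite ?unitmx_tr //.
  by rewrite -[u]trmxK E trmx_mul trmx_delta.
pose f' : 'rV_(1 + k.+2) := f *m Q.
have f'l : lsubmx f' = 0.
  have /matrixP/(_ 0 0) : col 0 (f *m Q) = 0 by rewrite colE -mulmxA -uE.
  rewrite !mxE => E; apply/matrixP => i j; rewrite !ord1 !mxE -[RHS]E.
  by apply: eq_bigr => l _; congr (_ * Q _ _); apply: val_inj.
have f'E : f' = row_mx 0 (rsubmx f') by rewrite -f'l hsubmxK.
have [|R Ru RE] := row_of_unitmx (v := rsubmx f').
  apply: contraNneq f0 => E; have : f' = 0 by rewrite f'E E row_mx0.
  by move=> /(congr1 (mulmx^~ (invmx Q))); rewrite mulmxK // mul0mx => ->.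
pose B : 'M_(1 + k.+2) := block_mx 1 0 0 R.
have Bu : B \in unitmx by rewrite unitmxE det_ublock det1 mul1r -unitmxE.
pose g : 'M_k.+3 := B *m invmx Q.
have gu : g \in unitmx by rewrite unitmx_mul Bu unitmx_inv.
have Be : B *m (delta_mx 0 0 : 'cV_(1 + k.+2)) = delta_mx 0 0.
  have -> : (delta_mx 0 0 : 'cV[F]_(1 + k.+2)) = delta_mx (lshift k.+2 0) 0.
    by congr delta_mx; apply: val_inj.
  rewrite delta_mx_ushift mul_block_col !mulmx0 mul0mx !addr0 mul1mx.
  by [].
have eB : (delta_mx 0 1 : 'rV_(1 + k.+2)) *m B = f'.
  have -> : (delta_mx 0 1 : 'rV[F]_(1 + k.+2)) = delta_mx 0 (rshift 1 0).
    by congr delta_mx; apply: val_inj.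
  rewrite delta_mx_rshift mul_row_block !mulmx0 !mul0mx !add0r -RE.
  by rewrite -f'E.
have gN : g *m N = delta_mx 0 1 *m g.
  have -> : g *m N = B *m delta_mx 0 0 *m f.
    by rewrite NE uE /g -!mulmxA (mulKmx Qu).
  rewrite [B *m _]Be -(mulmxK Qu f) -/f' -eB /g !mulmxA.
  by rewrite mul_delta_mx.
clearbody g; pose d := \row_(i < k.+3) (if i == inord 2 then (\det g)^-1 else 1).
have dE (i : 'I_k.+3) : (i < 2)%N -> d 0 i = 1.
  move=> i2; rewrite mxE; case: eqP => // ii; move: i2.
  by rewrite ii inordK.
exists (diag_mx d *m g).
  rewrite det_mulmx det_diag (bigD1 (inord 2)) //= big1 => [|i /negPf i2].
    by rewrite mxE eqxx mulr1 mulVf // -unitfE -unitmxE.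
  by rewrite mxE i2.
rewrite -mulmxA gN !mulmxA; congr (_ *m _).
apply/matrixP => i j; rewrite mul_diag_mx mul_mx_diag !mxE.
have [->|_] := eqVneq i 0; last by rewrite ?andbF /= mulr0 mul0r.
have [->|_] := eqVneq j 1; last by rewrite ?andbF /= mulr0 mul0r.
by have := dE 0 isT; have := dE 1 isT; rewrite !mxE => -> ->.
Qed.

End Transvections.

(** * Commutation of dyads *)

Section Dyads.
Variables (F : fieldType) (n : nat).
Implicit Types (u v w : 'cV[F]_n) (f g h : 'rV[F]_n).

Definition pairing f u : F := (f *m u) 0 0.
Local Notation "<< f , u >>" := (pairing f u) (f at level 50).

Lemma pairingE f u : f *m u = <<f, u>>%:M.
Proof. by rewrite [LHS]mx11_scalar. Qed.

Lemma pairing0P f u : f *m u = 0 <-> <<f, u>> = 0.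
Proof.
by split=> E; [rewrite /pairing E mxE | rewrite pairingE E raddf0].
Qed.

Lemma pairingZl a f u : << a *: f, u >> = a * <<f, u>>.
Proof. by rewrite /pairing -scalemxAl mxE. Qed.

Lemma pairingBl f g u : << f - g, u >> = << f, u >> - << g, u >>.
Proof. by rewrite /pairing mulmxBl !mxE. Qed.

Lemma pairingZr a f u : << f, a *: u >> = a * <<f, u>>.
Proof. by rewrite /pairing -scalemxAr mxE. Qed.

Lemma dyad_mul u f v g : u *m f *m (v *m g) = <<f, v>> *: (u *m g).
Proof.
by rewrite mulmxA -[u *m f *m v]mulmxA pairingE mul_mx_scalar -scalemxAl.
Qed.

Lemma dyad_eq0 u f : u *m f = 0 -> u = 0 \/ f = 0.
Proof.
move=> /matrixP uf; have [|/matrix0Pn[i [j]]] := eqVneq u 0; first by left.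
rewrite ord1 => ui; right; apply/matrixP => k l; rewrite ord1 mxE.
have := uf i l; rewrite !mxE big_ord1 => /eqP; rewrite mulf_eq0 (negPf ui).
by move=> /eqP.
Qed.

Lemma dyad_neq0 u f : u != 0 -> f != 0 -> u *m f != 0.
Proof. by move=> u0 f0; apply/eqP => /dyad_eq0[] E; move: u0 f0; rewrite E eqxx. Qed.

Lemma dyad_inj u f g : u != 0 -> u *m f = u *m g -> f = g.
Proof.
move=> u0 E; apply/eqP; rewrite -subr_eq0; apply/eqP.
have : u *m (f - g) = 0 by rewrite mulmxBr E subrr.
by move=> /dyad_eq0[] // E'; move: u0; rewrite E' eqxx.
Qed.

Lemma dyad_injr u v f : f != 0 -> u *m f = v *m f -> u = v.
Proof.
move=> f0 E; apply/eqP; rewrite -subr_eq0; apply/eqP.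
have : (u - v) *m f = 0 by rewrite mulmxBl E subrr.
by move=> /dyad_eq0[] // E'; move: f0; rewrite E' eqxx.
Qed.

Definition proportional m1 m2 (A B : 'M[F]_(m1, m2)) : Prop :=
  exists2 a, a != 0 & A = a *: B.

Lemma proportional_sym m1 m2 (A B : 'M[F]_(m1, m2)) :
  proportional A B -> proportional B A.
Proof.
by move=> [a a0 ->]; exists a^-1; rewrite ?invr_eq0 // scalerA mulVf ?scale1r.
Qed.

Lemma proportional_trans m1 m2 (A B C : 'M[F]_(m1, m2)) :
  proportional A B -> proportional B C -> proportional A C.
Proof.
by move=> [a a0 ->] [b b0 ->]; exists (a * b); rewrite ?mulf_neq0 ?scalerA.
Qed.

Lemma proportional_refl m1 m2 (A : 'M[F]_(m1, m2)) : proportional A A.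
Proof. by exists 1; rewrite ?oner_neq0 ?scale1r. Qed.

Lemma proportionalZ m1 m2 a (A B : 'M[F]_(m1, m2)) :
  A != 0 -> proportional A (a *: B) -> proportional A B.
Proof.
move=> A0 [b b0 E]; exists (b * a); last by rewrite -scalerA.
by apply: contraNneq A0 => ba; rewrite E scalerA ba scale0r.
Qed.

Lemma dyad_proportional u f v g :
  u *m f = v *m g -> u != 0 -> f != 0 -> proportional u v /\ proportional f g.
Proof.
move=> /matrixP E u0 f0.
have {}E i j : u i 0 * f 0 j = v i 0 * g 0 j.
  by have := E i j; rewrite !mxE !big_ord1.
have /matrix0Pn[i0 [j0]] := u0; rewrite ord1 => ui.
have /matrix0Pn[i1 [j1]] := f0; rewrite ord1 => fj.
have /andP[vi gj] : (v i0 0 != 0) && (g 0 j1 != 0).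
  by rewrite -negb_or -mulf_eq0 -E mulf_eq0 negb_or ui.
split.
  exists (g 0 j1 / f 0 j1); first by rewrite mulf_neq0 ?invr_eq0.
  by apply/matrixP => i j; rewrite ord1 mxE mulrAC [g _ _ * _]mulrC -E mulfK.
exists (v i0 0 / u i0 0); first by rewrite mulf_neq0 ?invr_eq0.
by apply/matrixP => i j; rewrite ord1 mxE mulrAC -E mulrAC mulfV ?mul1r.
Qed.

Lemma add1_commutator (A B : 'M[F]_n) :
  (1%:M + A) *m (1%:M + B) - (1%:M + B) *m (1%:M + A) = A *m B - B *m A.
Proof.
rewrite !mulmxDl !mulmxDr !mul1mx !mulmx1 !addrA opprD [1%:M + B + A]addrAC.
rewrite [X in X + (_ - _)]addrC; set Y := 1%:M + A + B.
by rewrite -addrA [Y + _]addrA subrr add0r.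
Qed.

(** If <f, v> is nonzero, multiplying the equality of the two products by f on
    the left gives <g, u> = 0, and then u g = 0. *)
Lemma dyad_comm u f v g :
  f *m u = 0 -> g *m v = 0 -> u != 0 -> f != 0 -> v != 0 -> g != 0 ->
  (1%:M + u *m f) *m (1%:M + v *m g) = (1%:M + v *m g) *m (1%:M + u *m f) ->
  <<f, v>> = 0 /\ <<g, u>> = 0.
Proof.
move=> fu gv u0 f0 v0 g0 C; have E : u *m f *m (v *m g) = v *m g *m (u *m f).
  by apply/subr0_eq; rewrite -add1_commutator C subrr.
rewrite !dyad_mul in E.
have fv : <<f, v>> = 0.
  apply/eqP/negPn/negP => fv0.
  have := congr1 (mulmx f) E; rewrite -!scalemxAr !mulmxA fu mul0mx scaler0.
  rewrite pairingE mul_scalar_mx scalerA => /esym/eqP.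
  rewrite scaler_eq0 (negPf f0) orbF mulf_eq0 (negPf fv0) orbF => /eqP gu.
  move: E; rewrite gu scale0r => /eqP.
  by rewrite scaler_eq0 (negPf fv0) (negPf (dyad_neq0 u0 g0)).
split=> //; move: E; rewrite fv scale0r => /esym/eqP.
by rewrite scaler_eq0 (negPf (dyad_neq0 v0 f0)) orbF => /eqP.
Qed.

(** As 1 + wh commutes with the two other elements, h kills u and v, and the
    relation expands to the first equality; multiplied by uf on the right, this
    equality shows that one pairing vanishes. *)
Lemma dyad_commutator u f v g w h :
  f *m u = 0 -> g *m v = 0 -> h *m w = 0 ->
  u != 0 -> f != 0 -> v != 0 -> g != 0 -> w != 0 -> h != 0 ->
  (1%:M + u *m f) *m (1%:M + w *m h) = (1%:M + w *m h) *m (1%:M + u *m f) ->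
  (1%:M + v *m g) *m (1%:M + w *m h) = (1%:M + w *m h) *m (1%:M + v *m g) ->
  (1%:M + u *m f) *m (1%:M + v *m g) =
    (1%:M + v *m g) *m (1%:M + u *m f) *m (1%:M + w *m h) ->
  <<f, v>> *: (u *m g) - <<g, u>> *: (v *m f) = w *m h /\
  <<f, v>> * <<g, u>> = 0.
Proof.
move=> fu gv hw u0 f0 v0 g0 w0 h0 C1 C2 R.
have [fw hu] := dyad_comm fu hw u0 f0 w0 h0 C1.
have [gw hv] := dyad_comm gv hw v0 g0 w0 h0 C2.
have E : <<f, v>> *: (u *m g) - <<g, u>> *: (v *m f) = w *m h.
  rewrite -!dyad_mul -add1_commutator R mulmxDr mulmx1 addrAC subrr add0r.
  rewrite -mulmxA [(1%:M + u *m f) *m _]mulmxDl mul1mx dyad_mul fw scale0r addr0.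
  by rewrite mulmxDl mul1mx dyad_mul gw scale0r addr0.
split=> //.
have := congr1 (mulmx^~ (u *m f)) E; rewrite mulmxBl -!scalemxAl !dyad_mul hu.
move/pairing0P: fu => ->; rewrite !scale0r scaler0 subr0 scalerA => /eqP.
by rewrite scaler_eq0 (negPf (dyad_neq0 u0 f0)) orbF => /eqP.
Qed.

End Dyads.

(** * Transvections satisfying the Steinberg relations *)

Local Notation "<< f , u >>" := (pairing f u) (f at level 50).

Section Steinberg.
Variables (F : fieldType) (k : nat).
Local Notation I := 'I_k.+3.
Local Notation M := 'M[F]_k.+3.

Definition transvection (x : M) : Prop :=
  exists (u : 'cV_k.+3) (f : 'rV_k.+3),
    [/\ x = 1%:M + u *m f, f *m u = 0, u != 0 & f != 0].

Record steinberg (q : I -> I -> M) : Prop := Steinberg {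
  steinberg_transvection : forall i j, i != j -> transvection (q i j);
  steinberg_comm : forall i j l m, i != j -> l != m -> j != l -> i != m ->
    q i j *m q l m = q l m *m q i j;
  steinberg_commutator : forall i j l, i != j -> j != l -> i != l ->
    q i j *m q j l = q j l *m q i j *m q i l }.

Lemma exists_third (i j : I) : exists l, (l != i) && (l != j).
Proof.
have /card_gt0P[l] : (0 < #|[predC [:: i; j]]|)%N.
  have := cardC (mem [:: i; j]); rewrite card_ord; case: posnP => // ->.
  by rewrite addn0 => E; have := card_size [:: i; j]; rewrite E.
by rewrite !inE negb_or; exists l.
Qed.

(** The relations force the columns: u and those of the q j 0 form a basis, and
    its dual basis consists of the rows of the q 0 j and of the common row of the
    q j 0. *)
Lemma steinberg_common_column (q : I -> I -> M) (u : 'cV_k.+3) :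
  steinberg q -> u != 0 ->
  (forall j, j != 0 -> exists f : 'rV_k.+3,
     [/\ q 0 j = 1%:M + u *m f, f *m u = 0 & f != 0]) ->
  exists2 P : M, P \in unitmx &
    forall i j, i != j -> q i j = 1%:M + P *m delta_mx i j *m invmx P.
Proof.
move=> [T C R] u0 T0.
have T0' j : exists f : 'rV_k.+3, j != 0 ->
    [/\ q 0 j = 1%:M + u *m f, f *m u = 0 & f != 0].
  by have [->|/T0[f fP]] := eqVneq j 0; [exists 0 | exists f].
have [f fP] := choice T0'.
have S1 j l : j != 0 -> l != 0 -> j != l -> exists v : 'cV_k.+3,
    [/\ q j l = 1%:M + v *m f l, << f j, v >> = 1, v != 0, f l *m v = 0 &
        forall m, m != 0 -> m != j -> << f m, v >> = 0].
  move=> j0 l0 jl; have [qj fju fj0] := fP j j0; have [ql flu fl0] := fP l l0.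
  have [v [g [qjl gv v0 g0]]] := T j l jl.
  have comm m : m != 0 -> m != j -> << f m, v >> = 0 /\ << g, u >> = 0.
    move=> m0 mj; have [qm fmu fm0] := fP m m0.
    apply: dyad_comm => //; rewrite -qm -qjl.
    by apply: C; rewrite // eq_sym.
  have [] // := @dyad_commutator _ _ u (f j) v g u (f l).
  - by rewrite -qj -ql; apply: C => //; rewrite eq_sym.
  - by rewrite -qjl -ql; apply: C => //; rewrite eq_sym.
  - by rewrite -qj -ql -qjl; apply: R => //; rewrite eq_sym.
  have [_ gu] := comm l l0 (contra_neq (@esym _ _ _) jl).
  rewrite gu scale0r subr0 scalemxAr => /(dyad_inj u0) E _.
  have c0 : << f j, v >> != 0.
    by apply: contraNneq fl0 => c0; rewrite -E c0 scale0r.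
  have fE m a : << f m, a *: v >> = a * << f m, v >> by apply: pairingZr.
  exists (<< f j, v >>^-1 *: v); split.
  - by rewrite qjl -E -scalemxAl -scalemxAr scalerA mulVf // scale1r.
  - by rewrite fE mulVf.
  - by rewrite scaler_eq0 invr_eq0 (negPf c0).
  - apply/pairing0P; rewrite fE; have [->] := comm l l0 (contra_neq (@esym _ _ _) jl).
    by rewrite mulr0.
  - by move=> m m0 mj; rewrite fE; have [->] := comm m m0 mj; rewrite mulr0.
have [w [g wP]] : exists (w : I -> 'cV_k.+3) (g : I -> 'rV_k.+3), forall j, j != 0 ->
    [/\ q j 0 = 1%:M + w j *m g j, << g j, u >> = 1, << g j, w j >> = 0,
        w j != 0 /\ g j != 0 &
     forall l, l != 0 -> << f l, w j >> = (l == j)%:R /\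
       (l != j -> q j l = 1%:M + w j *m f l)].
  suff H j : exists wg : 'cV_k.+3 * 'rV_k.+3, j != 0 ->
    [/\ q j 0 = 1%:M + wg.1 *m wg.2, << wg.2, u >> = 1, << wg.2, wg.1 >> = 0,
        wg.1 != 0 /\ wg.2 != 0 &
     forall l, l != 0 -> << f l, wg.1 >> = (l == j)%:R /\
       (l != j -> q j l = 1%:M + wg.1 *m f l)].
    have [wg wgP] := choice H.
    by exists (fun j => (wg j).1), (fun j => (wg j).2).
  have [->|j0] := eqVneq j 0; first by exists (0, 0).
  have [v [g [qj0 gv v0 g0]]] := T j 0 j0.
  have Hl l : l != 0 -> l != j -> [/\ q j l = 1%:M + (<< g, u >> *: v) *m f l,
      << g, u >> != 0 & << f j, << g, u >> *: v >> = 1 /\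
      forall m, m != 0 -> m != j -> << f m, << g, u >> *: v >> = 0].
    move=> l0 lj; have jl : j != l by rewrite eq_sym.
    have [vl [qjl fjv vl0 flv fmv]] := S1 j l j0 l0 jl.
    have [ql flu fl0] := fP l l0.
    have [g_vl fl_v] : << g, vl >> = 0 /\ << f l, v >> = 0.
      by apply: dyad_comm => //; rewrite -qj0 -qjl; apply: C => //; rewrite eq_sym.
    have [] // := @dyad_commutator _ _ v g u (f l) vl (f l).
    - by rewrite -qj0 -qjl; apply: C => //; rewrite eq_sym.
    - by rewrite -ql -qjl; apply: C => //; rewrite eq_sym.
    - by rewrite -qj0 -ql -qjl; apply: R => //; rewrite eq_sym.
    rewrite fl_v scale0r subr0 scalemxAl => /(dyad_injr fl0) E _; rewrite E; split=> //.
    by apply: contraNneq vl0 => gu; rewrite -E gu scale0r.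
  have [l0 /andP[l00 l0j]] := exists_third 0 j.
  have [_ c0 [fjw flw]] := Hl l0 l00 l0j.
  set c := << g, u >> in Hl c0 fjw flw.
  exists (c *: v, c^-1 *: g) => _ /=; split.
  - by rewrite -scalemxAl -scalemxAr scalerA mulfV // scale1r.
  - by rewrite pairingZl mulVf.
  - by rewrite pairingZl pairingZr; move/pairing0P: gv => ->; rewrite !mulr0.
  - by rewrite !scaler_eq0 invr_eq0 (negPf c0).
  - move=> l l0'; split; last by move=> lj; have [] := Hl l l0' lj.
    by have [->|lj] := eqVneq l j; rewrite ?fjw ?flw.
have gw j l : j != 0 -> l != 0 -> << g j, w l >> = (0 : F).
  move=> j0 l0; have [<-|jl] := eqVneq j l; first by have [] := wP j j0.
  have [qj _ /pairing0P gwj [wj0 gj0] _] := wP j j0.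
  have [ql _ /pairing0P gwl [wl0 gl0] _] := wP l l0.
  by apply: (dyad_comm gwj gwl wj0 gj0 wl0 gl0 _).1; rewrite -qj -ql; apply: C; rewrite // eq_sym.
pose b j := if j == 0 then u else w j.
pose d j := if j == 0 then g 1 else f j.
pose P : M := \matrix_(i, j) b j i 0.
pose Q : M := \matrix_(i, j) d i 0 j.
have QP : Q *m P = 1%:M.
  apply/matrixP => i j; have -> : (Q *m P) i j = << d i, b j >>.
    by rewrite /pairing !mxE; apply: eq_bigr => l _; rewrite !mxE.
  rewrite mxE /d /b; have [i0|i0] := eqVneq i 0; have [j0|j0] := eqVneq j 0.
  - by rewrite i0 j0 eqxx; have [] := wP 1 isT.
  - by rewrite gw // i0 eq_sym (negPf j0).
  - by have [_ /pairing0P -> _] := fP i i0; rewrite j0 (negPf i0).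
  - by have [_ _ _ _ /(_ i i0)[]] := wP j j0.
have [Qu Pu] := mulmx1_unit QP.
have PQ : invmx P = Q by rewrite -[Q]mulmx1 -(mulmxV Pu) mulmxA QP mul1mx.
exists P => // i j ij; rewrite PQ.
suff -> : q i j = 1%:M + b i *m d j.
  congr (_ + _); rewrite -[b i *m d j](_ : col i P *m row j Q = _).
    by rewrite colE rowE !mulmxA -[P *m _ *m _]mulmxA mul_delta_mx.
  by congr (_ *m _); apply/matrixP => x y; rewrite !ord1 !mxE.
rewrite /b /d; have [i0|i0] := eqVneq i 0; have [j0|j0] := eqVneq j 0.
- by move: ij; rewrite i0 j0 eqxx.
- by rewrite i0; have [] := fP j j0.
- have [E gu _ _ _] := wP i i0; rewrite j0 E; congr (_ + _ *m _).
  have [_ gu1 _ _ _] := wP 1 isT.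
  have : (g i - g 1) *m P = 0.
    apply/matrixP => x y; rewrite !ord1.
    have -> : ((g i - g 1) *m P) 0 y = << g i - g 1, b y >>.
      by rewrite /pairing !mxE; apply: eq_bigr => l _; rewrite !mxE.
    rewrite mxE pairingBl /b; have [_|y0] := eqVneq y 0.
      by rewrite gu gu1 subrr.
    by rewrite !gw ?subrr.
  by move=> /(congr1 (mulmx^~ (invmx P))); rewrite mulmxK // mul0mx => /subr0_eq.
- by have [_ _ _ _ /(_ j j0)[_ ->]] := wP i i0; rewrite 1?eq_sym.
Qed.

(** The relation between q 0 j, q j l and q 0 l shows that q 0 j and q 0 l have
    proportional columns or proportional rows. Proportionality being an
    equivalence relation, one of the two alternatives holds for all indices. *)
Lemma steinberg_row_or_column (q : I -> I -> M) : steinberg q ->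
  (exists2 u : 'cV_k.+3, u != 0 & forall j, j != 0 -> exists f : 'rV_k.+3,
     [/\ q 0 j = 1%:M + u *m f, f *m u = 0 & f != 0]) \/
  (exists2 f : 'rV_k.+3, f != 0 & forall j, j != 0 -> exists u : 'cV_k.+3,
     [/\ q 0 j = 1%:M + u *m f, f *m u = 0 & u != 0]).
Proof.
move=> [T C R].
have T0 j : exists uf : 'cV_k.+3 * 'rV_k.+3, j != 0 ->
    [/\ q 0 j = 1%:M + uf.1 *m uf.2, uf.2 *m uf.1 = 0, uf.1 != 0 & uf.2 != 0].
  have [->|j0] := eqVneq j 0; first by exists (0, 0).
  by have [|u [f H]] := T 0 j; [rewrite eq_sym | exists (u, f)].
have [uf ufP] := choice T0; clear T0.
pose u j := (uf j).1; pose f j := (uf j).2.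
have {}ufP j : j != 0 ->
    [/\ q 0 j = 1%:M + u j *m f j, f j *m u j = 0, u j != 0 & f j != 0].
  exact: ufP.
have alt j l : j != 0 -> l != 0 -> j != l ->
    proportional (u l) (u j) \/ proportional (f l) (f j).
  move=> j0 l0 jl; have [qj fuj uj0 fj0] := ufP j j0.
  have [ql ful ul0 fl0] := ufP l l0; have [v [g [qjl gv v0 g0]]] := T j l jl.
  have [] // := @dyad_commutator _ _ (u j) (f j) v g (u l) (f l).
  - by rewrite -qj -ql; apply: C => //; rewrite eq_sym.
  - by rewrite -qjl -ql; apply: C => //; rewrite eq_sym.
  - by rewrite -qj -ql -qjl; apply: R => //; rewrite eq_sym.
  move=> E /eqP; rewrite mulf_eq0 => /orP[] /eqP c0; move: E; rewrite c0 scale0r.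
    rewrite sub0r -scaleNr scalemxAr => /esym E.
    right; have [_] := dyad_proportional E ul0 fl0; exact: proportionalZ.
  rewrite subr0 scalemxAl => /esym E.
  left; have [] := dyad_proportional E ul0 fl0 => + _; exact: proportionalZ.
have [L|/existsNP[m /not_implyP[m0 Nm]]] :=
    pselect (forall l, l != 0 -> proportional (u l) (u 1)).
  left; have [_ _ u1 _] := ufP 1 isT; exists (u 1) => // j j0.
  have [a a0 uE] := L j j0; have [qj fuj uj0 fj0] := ufP j j0.
  exists (a *: f j); split; last by rewrite scaler_eq0 negb_or a0.
    by rewrite qj uE -scalemxAl -scalemxAr.
  apply/eqP; move/eqP: fuj; rewrite uE -scalemxAr -scalemxAl.
  by [].
right; have [_ _ _ f1] := ufP 1 isT; exists (f 1) => // j j0.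
suff [a a0 fE] : proportional (f j) (f 1).
  have [qj fuj uj0 fj0] := ufP j j0; exists (a *: u j); split.
  - by rewrite qj fE -scalemxAl -scalemxAr.
  - by move: fuj; rewrite fE -scalemxAr -scalemxAl.
  - by rewrite scaler_eq0 negb_or a0.
have m1 : 1 != m.
  by apply/eqP => m1; apply: Nm; rewrite -m1; apply: proportional_refl.
have f_m : proportional (f m) (f 1) by have [] := alt 1 m isT m0 m1.
have [->|jm] := eqVneq j m; first exact: f_m.
have [->|j1] := eqVneq j 1; first exact: proportional_refl.
have [uj|] := alt 1 j isT j0 (contra_neq (@esym _ _ _) j1); last by [].
have mj : m != j by rewrite eq_sym.
have [um|fm] := alt m j m0 j0 mj; last exact: proportional_trans fm f_m.
by case: Nm; apply: proportional_trans uj; apply: proportional_sym.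
Qed.

Lemma transvection_mulN n (u : 'cV[F]_n) (f : 'rV[F]_n) :
  f *m u = 0 -> (1%:M + u *m f) *m (1%:M - u *m f) = 1%:M.
Proof.
move=> fu; rewrite mulmxBr mulmx1 mulmxDl mul1mx dyad_mul.
by move/pairing0P: fu => ->; rewrite scale0r addr0 addrK.
Qed.

Lemma invmx_transvection n (u : 'cV[F]_n) (f : 'rV[F]_n) :
  f *m u = 0 -> invmx (1%:M + u *m f) = 1%:M - u *m f.
Proof.
move=> fu; have E := transvection_mulN fu; have [U _] := mulmx1_unit E.
by have := mulKmx U (1%:M - u *m f); rewrite E mulmx1.
Qed.

Lemma transvection_unit x : transvection x -> x \in unitmx.
Proof. by move=> [u [f [-> /transvection_mulN/mulmx1_unit[]]]]. Qed.

(** The inverse transpose exchanges rows and columns of transvections. *)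
Lemma steinberg_dual (q : I -> I -> M) :
  steinberg q -> steinberg (fun i j => (invmx (q i j))^T).
Proof.
move=> [T C R].
have U i j : i != j -> q i j \in unitmx by move=> /T /transvection_unit.
have invM (x y : M) : x \in unitmx -> y \in unitmx ->
    (invmx (x *m y))^T = (invmx x)^T *m (invmx y)^T.
  by move=> ux uy; rewrite -trmx_mul; congr (_^T); apply: invrM.
split.
- move=> i j /T [u [f [-> fu u0 f0]]]; exists (- f^T), u^T; split.
  + by rewrite invmx_transvection // linearB /= trmx1 trmx_mul mulNmx.
  + by rewrite mulmxN -trmx_mul fu trmx0 oppr0.
  + by rewrite oppr_eq0 -trmx0 (inj_eq trmx_inj).
  + by rewrite -trmx0 (inj_eq trmx_inj).
- by move=> i j l m ij lm jl im; rewrite -!invM ?U // C.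
- move=> i j l ij jl il; rewrite -!invM ?unitmx_mul ?U //.
  by rewrite (R _ _ _ ij jl il).
Qed.

Lemma steinberg_conj (q : I -> I -> M) : steinberg q ->
  exists2 P : M, P \in unitmx &
    (forall i j, i != j -> q i j = 1%:M + P *m delta_mx i j *m invmx P) \/
    (forall i j, i != j -> q i j = 1%:M - P *m delta_mx j i *m invmx P).
Proof.
move=> S; have [[u u0 uP]|[f f0 fP]] := steinberg_row_or_column S.
  by have [P Pu PE] := steinberg_common_column S u0 uP; exists P => //; left.
have [||P Pu PE] := steinberg_common_column (steinberg_dual S) (u := f^T).
- by rewrite -trmx0 (inj_eq trmx_inj).
- move=> j /fP[u [-> fu u0]]; exists (- u^T); split.
  + by rewrite invmx_transvection // linearB /= trmx1 trmx_mul mulmxN.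
  + by rewrite mulNmx -trmx_mul fu trmx0 oppr0.
  + by rewrite oppr_eq0 -trmx0 (inj_eq trmx_inj).
exists (invmx P)^T; first by rewrite unitmx_tr unitmx_inv.
right => i j ij.
have qE : invmx (q i j) =
    1%:M + ((invmx P)^T *m delta_mx j (0 : 'I_1)) *m (delta_mx 0 i *m P^T).
  rewrite -[invmx (q i j)]trmxK PE // linearD /= trmx1 !trmx_mul trmx_delta; congr (_ + _).
  by rewrite !mulmxA -[_ *m delta_mx j 0 *m _]mulmxA mul_delta_mx.
rewrite -[q i j]invmxK qE invmx_transvection; last first.
  rewrite mulmxA -[_ *m P^T *m _]mulmxA -trmx_mul mulVmx // trmx1 mulmx1.
  by rewrite mul_delta_mx_0.
rewrite trmx_inv invmxK; congr (_ - _).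
by rewrite !mulmxA -[_ *m delta_mx j 0 *m _]mulmxA mul_delta_mx.
Qed.

End Steinberg.

(** * Elementary matrices in the special linear group *)

Section SpecialLinearGroup.
Variables (F : fieldType) (n : nat).
Local Notation G := (SL n F).
Implicit Types x y z g : G.

Lemma SLvalM x y : SLval (x * y)%g = SLval x *m SLval y.
Proof. by []. Qed.

Lemma SLval1 : SLval (1%g : G) = 1%:M.
Proof. by []. Qed.

Lemma SLvalV x : SLval (x^-1)%g = invmx (SLval x).
Proof. by []. Qed.

Lemma SL_inj : injective (@SLval n F).
Proof. exact: val_inj. Qed.

Definition mkSL (A : 'M[F]_n) : G := insubd (1%g : G) A.

Lemma mkSLK A : \det A = 1 -> SLval (mkSL A) = A.
Proof. by move=> dA; apply: insubdK; rewrite unfold_in dA. Qed.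

Lemma SL_comm x y :
  (x * y = y * x)%g <-> SLval x *m SLval y = SLval y *m SLval x.
Proof. by rewrite -!SLvalM; split=> [->|/SL_inj]. Qed.

Definition elem i j (c : F) : G :=
  if i == j then 1%g else mkSL (1%:M + c *: delta_mx i j).

Lemma elem_sqzero (i j : 'I_n) (c : F) : i != j ->
  (c *: delta_mx i j) *m (c *: delta_mx i j) = 0 :> 'M[F]_n.
Proof.
by move=> ij; rewrite -scalemxAl -scalemxAr mul_delta_mx_0 ?scaler0 // eq_sym.
Qed.

Lemma elemE i j c : i != j -> SLval (elem i j c) = 1%:M + c *: delta_mx i j.
Proof.
move=> ij; rewrite /elem (negPf ij) mkSLK //.
exact/det_add_sqzero/elem_sqzero.
Qed.

Lemma elem_diag i c : elem i i c = 1%g.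
Proof. by rewrite /elem eqxx. Qed.

Lemma elemD i j a b : (elem i j a * elem i j b)%g = elem i j (a + b).
Proof.
have [->|ij] := eqVneq i j; first by rewrite !elem_diag mulg1.
apply: SL_inj; rewrite SLvalM !elemE // mulmxDl mul1mx mulmxDr mulmx1.
rewrite -scalemxAl -scalemxAr mul_delta_mx_0 1?eq_sym // !scaler0 addr0.
by rewrite scalerDl -!addrA [b *: _ + _]addrC.
Qed.

Lemma elem0 i j : elem i j 0 = 1%g.
Proof.
have [->|ij] := eqVneq i j; first by rewrite !elem_diag.
by apply: SL_inj; rewrite elemE // scale0r addr0.
Qed.

Lemma elemV i j a : (elem i j a)^-1%g = elem i j (- a).
Proof.
apply/esym; rewrite -[LHS]mulg1 -(mulgV (elem i j a)) mulgA elemD addNr elem0.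
by rewrite mul1g.
Qed.

Lemma elem_inj i j : i != j -> injective (elem i j).
Proof.
move=> ij a b /(congr1 (@SLval n F)); rewrite !elemE // => /addrI.
by move=> /matrixP/(_ i j); rewrite !mxE !eqxx !mulr1.
Qed.

Lemma elem_comm i j l m a b : j != l -> i != m ->
  (elem i j a * elem l m b = elem l m b * elem i j a)%g.
Proof.
move=> jl im; have [->|ij] := eqVneq i j; first by rewrite elem_diag mul1g mulg1.
have [->|lm] := eqVneq l m; first by rewrite elem_diag mul1g mulg1.
apply/SL_comm/subr0_eq; rewrite !elemE // add1_commutator.
rewrite -!scalemxAl -!scalemxAr !mul_delta_mx_0 ?scaler0 ?subrr // eq_sym //.
Qed.

Lemma add1_commutator_sqzero (A B : 'M[F]_n) : A *m A = 0 -> B *m A = 0 ->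
  (1%:M + A) *m (1%:M + B) = (1%:M + B) *m (1%:M + A) *m (1%:M + A *m B).
Proof.
move=> A2 BA; have -> : (1%:M + B) *m (1%:M + A) = 1%:M + A + B.
  by rewrite mulmxDl mul1mx mulmxDr mulmx1 BA addr0.
rewrite [RHS]mulmxDr mulmx1 [in RHS]mulmxDl [in RHS]mulmxDl mul1mx !mulmxA.
rewrite A2 BA !mul0mx !addr0 mulmxDl mul1mx mulmxDr mulmx1.
by rewrite addrA [1%:M + B + A]addrAC.
Qed.

Lemma elem_commutator i j l a b : i != j -> j != l -> i != l ->
  [~ elem i j a, elem j l b]%g = elem i l (a * b).
Proof.
move=> ij jl il; apply: (mulgI (elem j l b * elem i j a)%g); rewrite -commgC.
apply: SL_inj; rewrite !SLvalM !elemE // add1_commutator_sqzero ?elem_sqzero //.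
  by rewrite -scalemxAl -scalemxAr mul_delta_mx scalerA.
by rewrite -scalemxAl -scalemxAr mul_delta_mx_0 ?scaler0 // eq_sym.
Qed.

End SpecialLinearGroup.

(** * Frames *)

Section Frame.
Variables (F : fieldType) (k : nat).
Local Notation I := 'I_k.+3.
Local Notation G := (SL k.+3 F).
Implicit Types x y z g : G.

Definition central z := forall y, (z * y = y * z)%g.

Lemma central_scalar z : central z -> exists c, SLval z = c%:M.
Proof.
move=> Cz; have C (i j : I) : i != j ->
    SLval z *m delta_mx i j = delta_mx i j *m SLval z.
  move=> ij; have /SL_comm := Cz (elem i j 1); rewrite elemE // scale1r.
  by rewrite mulmxDl mulmxDr mul1mx mulmx1 => /addrI.
have E (i j l : I) : i != j ->
    SLval z l i = (l == i)%:R * SLval z j j.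
  move=> ij; have /matrixP/(_ l j) := C i j ij; rewrite !mxE.
  rewrite (bigD1 i) //= big1 => [|m /negPf mi]; last by rewrite !mxE mi mulr0.
  rewrite (bigD1 j) //= big1 => [|m /negPf mj]; last by rewrite !mxE mj andbF mul0r.
  by rewrite !mxE !eqxx mulr1 !addr0 andbT.
exists (SLval z 0 0); apply/matrixP => i j; rewrite mxE.
have [l lj] : exists l : I, j != l.
  by have [l /andP[]] := exists_third j j; exists l; rewrite eq_sym.
rewrite (E j l) //; case: eqP => [_|_]; last by rewrite mul0r.
rewrite mul1r mulr1n.
have [->//|l0] := eqVneq l 0.
by have := E 0 l 0; rewrite eqxx mul1r => -> //; rewrite eq_sym.
Qed.

Lemma scalar_central z c : SLval z = c%:M -> central z.
Proof. by move=> zc y; apply/SL_comm; rewrite zc scalar_mxC. Qed.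

Definition i2 : I := @Ordinal k.+3 2 isT.

(** First-order properties of the e_ij(1) that characterize them up to an
    automorphism of the group. In characteristic 0, the traces of the powers of
    q_01 in [frame_char0] are equal, which makes q_01 unipotent; the range of
    exponents comes from the degree of its characteristic polynomial. Inside
    group scope the index 1 is written 1%R: the unit of the additive group of
    indices is 0. *)
Record frame (q : I -> I -> G) : Prop := Frame {
  frame_diag : forall i, q i i = 1%g;
  frame_neq1 : q 0 1%R <> 1%g;
  frame_conj : forall i j, i != j -> exists g, (q i j * g = g * q 0 1%R)%g;
  frame_comm : forall i j l m, i != j -> l != m -> j != l -> i != m ->
    (q i j * q l m = q l m * q i j)%g;
  frame_commutator : forall i j l, i != j -> j != l -> i != l ->
    [~ q i j, q j l]%g = q i l;
  frame_centralizer : forall y,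
    (forall j, j != 0 -> y * q 0 j = q 0 j * y)%g ->
    central y \/ exists z g, central z /\ (y * g = z * (g * q 0 1%R))%g;
  frame_pchar : forall p, p \in [pchar F] -> (q 0 1%R ^+ p = 1)%g;
  frame_char0 : [pchar F] =i pred0 -> forall m : I,
    exists g, (q 0 1%R ^+ m.+2 * g = g * q 0 1%R)%g }.

Lemma SLvalX x m : SLval (x ^+ m)%g = SLval x ^+ m.
Proof.
by elim: m => [|m IH]; rewrite ?expg0 ?expr0 // expgS exprS SLvalM IH.
Qed.

Lemma SLval_unit x : SLval x \is a GRing.unit.
Proof. exact: SL_unitmx. Qed.

Lemma rank1_conj_elem x (N : 'M_k.+3) : SLval x = 1%:M + N ->
  \rank N = 1%N -> N *m N = 0 -> exists g, (x * g = g * elem 0 1%R 1%R)%g.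
Proof.
move=> xN rN N2; have [A dA AN] := sqzero_rank1_conj rN N2.
exists (mkSL A)^-1%g; apply: (mulgI (mkSL A)); rewrite !mulgA mulgV mul1g.
apply: (mulIg (mkSL A)); rewrite -!mulgA mulVg mulg1.
apply: SL_inj; rewrite !SLvalM mkSLK // elemE // scale1r xN.
by rewrite mulmxDr mulmx1 mulmxDl mul1mx AN.
Qed.

Lemma rank_delta (i j : I) c : c != 0 -> \rank (c *: delta_mx i j : 'M[F]_k.+3) = 1%N.
Proof. by move=> c0; rewrite mxrank_scale_nz // mxrank_delta. Qed.

Lemma elem_conj (i j : I) (c : F) : i != j -> c != 0 ->
  exists g, (elem i j c * g = g * elem 0 1%R 1%R)%g.
Proof.
move=> ij c0; apply: rank1_conj_elem (elemE c ij) _ _.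
  exact: rank_delta.
exact: elem_sqzero.
Qed.

Lemma elemX (i j : I) (c : F) m : (elem i j c ^+ m)%g = elem i j (c *+ m).
Proof.
elim: m => [|m IH]; first by rewrite expg0 mulr0n elem0.
by rewrite expgS IH elemD mulrS.
Qed.

(** Commuting with the matrix units E_0j, y is a scalar outside its first row.
    Its determinant is then a power of the scalar. *)
Lemma first_row_centralizer y :
  (forall j : I, j != 0 -> y * elem 0 j 1%R = elem 0 j 1%R * y)%g ->
  exists (c : F) (f : 'rV_k.+3), [/\ SLval y = c *: (1%:M + delta_mx 0 0 *m f),
    f *m delta_mx 0 (0 : 'I_1) = 0 & c ^+ k.+3 = 1].
Proof.
move=> C.
have E (j l : I) : j != 0 -> SLval y j l = (l == j)%:R * SLval y 0 0.
  move=> j0; have /SL_comm := C j j0; rewrite elemE; last by rewrite eq_sym.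
  rewrite scale1r mulmxDl mulmxDr mul1mx mulmx1 => /addrI /matrixP/(_ 0 l); rewrite !mxE.
  rewrite (bigD1 0) //= big1 => [|m /negPf m0]; last by rewrite !mxE m0 mulr0.
  rewrite (bigD1 j) //= big1 => [|m /negPf mj]; last by rewrite !mxE mj mul0r.
  by rewrite !mxE !eqxx mul1r !addr0 /= => <-; rewrite mulrC.
pose c := SLval y 0 0; pose f' : 'rV_k.+3 := \row_l (if l == 0 then 0 else SLval y 0 l).
have yE : SLval y = c%:M + delta_mx 0 (0 : 'I_1) *m f'.
  apply/matrixP => j l; rewrite !mxE big_ord1 !mxE.
  have [->|j0] := eqVneq j 0; last by rewrite E // eq_sym mul0r addr0 mulr_natl.
  by rewrite mul1r eq_sym; case: eqP => [->|_]; rewrite ?addr0 ?add0r.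
have fe : f' *m delta_mx 0 (0 : 'I_1) = 0.
  apply/matrixP => a b; rewrite !ord1 !mxE (bigD1 0) //= big1 => [|m /negPf m0].
    by rewrite !mxE /= mul0r addr0.
  by rewrite !mxE m0 mulr0.
have N2 (f : 'rV[F]_k.+3) : f *m delta_mx 0 (0 : 'I_1) = 0 ->
    delta_mx 0 (0 : 'I_1) *m f *m (delta_mx 0 (0 : 'I_1) *m f) = 0 :> 'M_k.+3.
  by move=> fe0; rewrite mulmxA -[_ *m f *m _]mulmxA fe0 mulmx0 mul0mx.
have c0 : c != 0.
  apply/eqP => c0; have := N2 f' fe; move: yE; rewrite c0 raddf0 add0r => <-.
  move=> /(congr1 (mulmx (invmx (SLval y)))); rewrite mulKmx ?SL_unitmx // mulmx0.
  by move=> y0; have := SL_det y; rewrite y0 det0 => /esym/eqP; rewrite oner_eq0.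
exists c, (c^-1 *: f').
have fe' : (c^-1 *: f') *m delta_mx 0 (0 : 'I_1) = 0 by rewrite -scalemxAl fe scaler0.
have yE' : SLval y = c *: (1%:M + delta_mx 0 0 *m (c^-1 *: f')).
  by rewrite scalerDr scalemx1 -scalemxAr scalerA mulfV // scale1r.
split=> //; have := SL_det y.
by rewrite yE' detZ det_add_sqzero ?mulr1 //; apply: N2.
Qed.

Lemma frame_elem : frame (fun i j => elem i j 1).
Proof.
split.
- by move=> i; apply: elem_diag.
- by rewrite -(elem0 F (0 : I) 1) => /elem_inj/eqP; rewrite oner_eq0 => /(_ isT).
- by move=> i j ij; apply: elem_conj; rewrite ?oner_neq0.
- by move=> i j l m _ _ jl im; apply: elem_comm.
- by move=> i j l ij jl il; rewrite elem_commutator // mulr1.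
- move=> y /first_row_centralizer [c [f [yE fe cn]]].
  have [f0|f0] := eqVneq f 0.
    left; apply: (@scalar_central _ c); rewrite yE f0 mulmx0 addr0.
    by rewrite scalemx1.
  right; pose z := mkSL (c%:M : 'M[F]_k.+3).
  have zE : SLval z = c%:M by rewrite mkSLK // det_scalar.
  have zC := scalar_central zE.
  pose N : 'M_k.+3 := delta_mx 0 (0 : 'I_1) *m f.
  have N2 : N *m N = 0.
    by rewrite /N mulmxA -[_ *m f *m _]mulmxA fe mulmx0 mul0mx.
  have rN : \rank N = 1%N.
    apply/eqP; rewrite eqn_leq (leq_trans (mxrankM_maxl _ _)) ?rank_leq_col //.
    rewrite lt0n mxrank_eq0 dyad_neq0 //.
    by apply/eqP => /matrixP/(_ 0 0)/eqP; rewrite !mxE oner_eq0.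
  have [|g gE] := @rank1_conj_elem (z^-1 * y)%g N _ rN N2.
    apply: (can_inj (mulKmx (SL_unitmx z))); rewrite -SLvalM mulgA mulgV mul1g.
    by rewrite yE zE mul_scalar_mx.
  exists z, g; split=> //; rewrite -gE !mulgA mulgV mul1g //.
- move=> p pF; rewrite elemX.
  by rewrite (pcharf0 pF) elem0.
- move=> ch0 m; rewrite elemX; apply: elem_conj => //.
  by rewrite (iffLR (pcharf0P F) ch0).
Qed.

Lemma frame_nilpotent (q : I -> I -> G) : frame q ->
  exists m, (SLval (q 0 1) - 1) ^+ m = 0.
Proof.
move=> Q; have [[p pF]|noP] := pselect (exists p, p \in [pchar F]).
  exists p; apply: pchar_nilpotent => //.
  by rewrite -SLvalX (frame_pchar Q pF).
have ch0 : [pchar F] =i pred0.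
  by move=> p; rewrite inE; apply/negP => pF; apply: noP; exists p.
apply: trace_nilpotent => // [|m mk]; first exact: SLval_unit.
have [g gE] := frame_char0 Q ch0 (Ordinal (mk : m < k.+3)%N).
have E : SLval (q 0 1%R ^+ m.+2)%g *m SLval g = SLval g *m SLval (q 0 1).
  exact: (congr1 (@SLval _ _) gE).
rewrite SLvalX in E.
have -> : SLval (q 0 1) ^+ m.+2 = SLval g *m SLval (q 0 1) *m invmx (SLval g).
  by rewrite -E mulmxK ?SL_unitmx.
by rewrite mxtrace_mulC mulKmx ?SL_unitmx.
Qed.

Lemma sub1_comm (R : pzRingType) (a b : R) :
  a * b = b * a -> (a - 1) * (b - 1) = (b - 1) * (a - 1).
Proof.
move=> ab; apply: commrB; last exact: commr1.
by apply/commr_sym/commrB; [apply: commr_sym | apply: commr1].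
Qed.

(** The element 1 + X centralizes the first row of the frame, and is not central:
    a scalar square-zero matrix is 0. *)
Lemma frame_sqzero_conj (q : I -> I -> G) (X : 'M_k.+3) : frame q ->
  X * X = 0 -> X != 0 ->
  (forall j, j != 0 -> X * (SLval (q 0 j) - 1) = (SLval (q 0 j) - 1) * X) ->
  exists g, X * SLval g = SLval g * (SLval (q 0 1) - 1).
Proof.
move=> Q X2 X0 XC; pose y : G := mkSL (1%:M + X).
have yE : SLval y = 1 + X by rewrite mkSLK //; apply: det_add_sqzero.
have yC j : j != 0 -> (y * q 0 j = q 0 j * y)%g.
  move=> /XC; rewrite mulrBr mulrBl mulr1 mul1r => /addIr E.
  by apply/SL_comm; rewrite yE !mulmxE mulrDl mulrDr mul1r mulr1 E.
have [/central_scalar [c yc]|[z [g [/central_scalar [c zc]]]]] :=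
    frame_centralizer Q yC.
  have XE : X = (c - 1)%:M by rewrite raddfB /= -yc yE addrC addrA addNr add0r.
  move: X2 X0; rewrite XE -mulmxE -scalar_mxM => /matrixP/(_ 0 0).
  rewrite !mxE mulr1n => /eqP; rewrite mulf_eq0 orbb => /eqP ->.
  by rewrite raddf0 eqxx.
move=> /(congr1 (@SLval _ _)); rewrite !SLvalM yE zc mul_scalar_mx => E.
have [m Nm] := frame_nilpotent Q.
exists g; apply: (@scalar_conj_nilpotent _ _ _ _ _ c m 2) => //.
- exact: SLval_unit.
- by rewrite [1 + (_ - 1)]addrC subrK -!mulmxE E.
Qed.

(** Let N_j = q_0j - 1. By [frame_sqzero_conj], a nonzero square-zero matrix that
    commutes with all the N_j is conjugate to N_1. For the last nonzero power of
    N_1 this gives N_1^2 = 0, and [rank_one_of_sqzero] applies to the N_j. *)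
Lemma frame_transvection (q : I -> I -> G) : frame q ->
  forall i j, i != j -> transvection (SLval (q i j)).
Proof.
move=> Q.
pose N j := SLval (q 0 j) - 1.
have NE j : SLval (q 0 j) = 1 + N j by rewrite /N addrC subrK.
have NC i j : i != 0 -> j != 0 -> N i * N j = N j * N i.
  move=> i0 j0; apply: sub1_comm; rewrite -!mulmxE -!SLvalM.
  by rewrite (frame_comm Q) // eq_sym.
have cj i j : i != j -> exists g, (SLval (q i j) - 1) * SLval g = SLval g * N 1.
  move=> ij; have [g /(congr1 (@SLval _ _))] := frame_conj Q ij.
  rewrite !SLvalM NE !mulmxE => E; exists g.
  by rewrite mulrBl E mul1r mulrDr mulr1 addrC addKr.
have cj0 j : j != 0 -> exists g, N j * SLval g = SLval g * N 1.
  by move=> j0; apply: cj; rewrite eq_sym.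
have N10 : N 1 != 0.
  apply/eqP => N0; apply: (frame_neq1 Q); apply: SL_inj.
  by rewrite NE N0 addr0.
have N1sq : N 1 * N 1 = 0.
  have [m Nm] := frame_nilpotent Q.
  have [s [X0 X2]] := nilpotent_sqzero_power Nm N10.
  have [j j0|g gE] := frame_sqzero_conj Q X2 X0.
    by apply/commr_sym/commrX/(NC j 1).
  apply: (mulrI (SLval_unit g)); rewrite mulr0 mulrA -gE -mulrA -gE mulrA X2.
  by rewrite mul0r.
have transfer (A : 'M_k.+3) g : A * SLval g = SLval g * N 1 ->
    [/\ A * A = 0, \rank A = \rank (N 1) & A != 0].
  move=> E; split.
  - apply: (mulIr (SLval_unit g)); rewrite mul0r -mulrA E mulrA E -mulrA N1sq.
    by rewrite mulr0.
  - rewrite -(mxrankMfree A (B := SLval g)) ?row_free_unit ?SL_unitmx //.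
    rewrite mulmxE E -mulmxE; apply/eqP; rewrite -mxrank_tr trmx_mul.
    by rewrite mxrankMfree ?mxrank_tr // row_free_unit unitmx_tr SL_unitmx.
  - apply: contraNneq N10 => A0; apply/eqP; apply: (mulrI (SLval_unit g)).
    by rewrite -E A0 mulr0 mul0r.
have lift0 j : lift ord0 j != 0 :> I by rewrite eq_sym neq_lift.
have rN1 : \rank (N 1) = 1%N.
  have -> : 1 = lift ord0 ord0 :> I by apply: val_inj.
  apply: (@rank_one_of_sqzero F _ k.+2 (fun j : 'I_k.+2 => N (lift ord0 j))).
  - by move=> s t; apply: NC.
  - by move=> s; have [g /transfer[]] := cj0 _ (lift0 s).
  - move=> s X X2 X0 XC; have [g /transfer[_ -> _]] := cj0 _ (lift0 s).
    have [j j0|h /transfer[]//] := frame_sqzero_conj Q X2 X0.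
    by have [l ->|E] := unliftP ord0 j; [apply: XC | move: j0; rewrite E eqxx].
  - by have [g /transfer[]] := cj0 _ (lift0 ord0).
move=> i j /cj [g /transfer[A2]]; rewrite rN1 => rA A0.
have [u [f AE]] := rank1_dyad rA.
have [u0 f0] : u != 0 /\ f != 0.
  by split; apply/eqP => E; move: A0; rewrite AE E ?mul0mx ?mulmx0 eqxx.
exists u, f; split=> //; first by rewrite -AE addrC subrK.
apply/pairing0P/eqP; move: A2; rewrite AE -mulmxE dyad_mul => /eqP.
by rewrite scaler_eq0 (negPf (dyad_neq0 u0 f0)) orbF.
Qed.

Lemma frame_steinberg (q : I -> I -> G) :
  frame q -> steinberg (fun i j => SLval (q i j)).
Proof.
move=> Q; split; first exact: frame_transvection.
  move=> i j l m ij lm jl im; rewrite -!SLvalM.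
  by rewrite (frame_comm Q).
move=> i j l ij jl il; rewrite -!SLvalM -(frame_commutator Q ij jl il).
by rewrite [in LHS]commgC.
Qed.

Lemma group_isomorphism (gT hT : groupType) (h : gT -> hT) :
  bijective h -> {morph h : x y / (x * y)%g} ->
  isomorphism (h : group_structure gT -> group_structure hT).
Proof.
move=> bh hM.
have h1 : h 1%g = 1%g by apply: (mulgI (h 1%g)); rewrite -hM !mulg1.
split=> //; last by case.
case=> xs /=; [exact: hM | | exact: h1].
by apply: (mulgI (h (xs ord0))); rewrite -hM !mulgV.
Qed.

Lemma conj_isomorphism (P : 'M[F]_k.+3) : P \in unitmx ->
  exists2 a : G -> G,
    isomorphism (a : group_structure G -> group_structure G) &
    forall x, SLval (a x) = P *m SLval x *m invmx P.
Proof.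
move=> Pu; pose c (P : 'M_k.+3) x : G := mkSL (P *m SLval x *m invmx P).
have cE R x : R \in unitmx -> SLval (c R x) = R *m SLval x *m invmx R.
  move=> Ru; rewrite mkSLK // !det_mulmx SL_det mulr1 -det_mulmx mulmxV //.
  by rewrite det1.
have cK R : R \in unitmx -> cancel (c R) (c (invmx R)).
  move=> Ru x; apply: SL_inj; rewrite !cE ?unitmx_inv // invmxK.
  by rewrite -!mulmxA mulKmx // mulmxA mulmxKV.
exists (c P) => [|x]; last exact: cE.
apply: group_isomorphism.
  exists (c (invmx P)); first exact: cK.
  by move=> x; rewrite -[in X in c X _](invmxK P) cK // unitmx_inv.
move=> x y; apply: SL_inj; rewrite SLvalM !cE // SLvalM.
by rewrite !mulmxA mulmxKV.
Qed.

Lemma dual_isomorphism :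
  exists2 a : G -> G,
    isomorphism (a : group_structure G -> group_structure G) &
    forall x, SLval (a x) = (invmx (SLval x))^T.
Proof.
pose a x : G := mkSL (invmx (SLval x))^T.
have aE x : SLval (a x) = (invmx (SLval x))^T.
  by rewrite mkSLK // det_tr det_inv SL_det invr1.
exists a => //; apply: group_isomorphism.
  by exists a => x; apply: SL_inj; rewrite !aE trmx_inv trmxK invmxK.
move=> x y; apply: SL_inj; rewrite SLvalM !aE SLvalM -trmx_mul; congr (_^T).
by apply: invrM; apply: SL_unitmx.
Qed.

(** The automorphism is a conjugation by a matrix of GL_n(F), possibly composed
    with the inverse transpose, so that its values on the e_02(c) are affine in
    c. *)
Lemma frame_automorphism (q : I -> I -> G) : frame q ->
  exists2 a : G -> G,
    isomorphism (a : group_structure G -> group_structure G) &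
    (forall i j, a (elem i j 1) = q i j) /\
    (forall c, SLval (a (elem 0 i2 c)) = 1%:M + c *: (SLval (q 0 i2) - 1%:M)).
Proof.
move=> Q; have [P Pu PE] := steinberg_conj (frame_steinberg Q).
have [b bi bE] := conj_isomorphism Pu.
have fin a : isomorphism (a : group_structure G -> group_structure G) ->
    (forall i j c, i != j -> SLval (a (elem i j c)) =
       1%:M + c *: (SLval (q i j) - 1%:M)) ->
    (forall i j, a (elem i j 1) = q i j) /\
    (forall c, SLval (a (elem 0 i2 c)) = 1%:M + c *: (SLval (q 0 i2) - 1%:M)).
  move=> [_ /(_ GOne (fun=> 1%g)) a1 _] aE; split=> [i j|c]; last exact: aE.
  have [->|ij] := eqVneq i j; first by rewrite elem_diag (frame_diag Q).
  by apply: SL_inj; rewrite aE // scale1r addrC subrK.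
case: PE => PE.
  exists b => //; apply: fin => // i j c ij.
  rewrite bE elemE // PE // mulmxDr mulmx1 mulmxDl mulmxV //.
  by rewrite [_ - 1%:M]addrC addKr -scalemxAr -scalemxAl.
have [d di dE] := dual_isomorphism.
exists (fun x => b (d x)); first exact: (isomorphism_comp bi di).
apply: (fin (fun x => b (d x))) => [|i j c ij]; first exact: (isomorphism_comp bi di).
rewrite bE; have -> : SLval (d (elem i j c)) = 1%:M - c *: delta_mx j i.
  rewrite dE -SLvalV elemV elemE // linearD /= trmx1 linearZ /= trmx_delta.
  by rewrite scaleNr.
rewrite PE // mulmxBr mulmx1 mulmxBl mulmxV //.
by rewrite [_ - 1%:M]addrC addKr scalerN -scalemxAr -scalemxAl.
Qed.

End Frame.

(** * Bounded generation by elementary matrices *)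

Section BoundedGeneration.
Variables (F : fieldType) (k : nat).
Local Notation I := 'I_k.+3.
Local Notation G := (SL k.+3 F).
Implicit Types x y z g : G.

Fixpoint elem_products (ps : seq (I * I)) x : Prop :=
  match ps with
  | [::] => x = 1%g
  | p :: ps => exists c y, elem_products ps y /\ x = (elem p.1 p.2 c * y)%g
  end.

Lemma elem_products_cat ps ps' x y :
  elem_products ps x -> elem_products ps' y -> elem_products (ps ++ ps') (x * y)%g.
Proof.
elim: ps x => [|p ps IH] x /=; first by move=> ->; rewrite mul1g.
move=> [c [z [Hz ->]]] Hy; exists c, (z * y)%g; rewrite mulgA; split=> //.
exact: IH.
Qed.

Lemma elem_products1 ps : elem_products ps 1%g.
Proof.
elim: ps => [|p ps IH] //=; exists 0, 1%g; split=> //.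
by rewrite elem0 mulg1.
Qed.

Lemma elem_products_elem ps i j c :
  (i, j) \in ps -> elem_products ps (elem i j c).
Proof.
elim: ps => //= p ps IH; rewrite in_cons => /orP[/eqP <-|/IH H].
  by exists c, 1%g; rewrite mulg1; split=> //; apply: elem_products1.
by exists 0, (elem i j c); rewrite elem0 mul1g.
Qed.

(** A product of N arbitrary elementary matrices is a product along this fixed
    list of positions, the coefficients elsewhere being 0. *)
Definition positions N : seq (I * I) := flatten (nseq N (enum {: I * I})).

Definition generated N x := elem_products (positions N) x.

Lemma generatedM N N' x y :
  generated N x -> generated N' y -> generated (N + N') (x * y)%g.
Proof.
move=> Hx Hy; rewrite /generated /positions nseqD flatten_cat.
exact: elem_products_cat.
Qed.

Lemma generated1 N : generated N 1%g.
Proof. exact: elem_products1. Qed.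

Lemma generated_elem i j c : generated 1 (elem i j c).
Proof.
by apply: elem_products_elem; rewrite /positions /= cats0 mem_enum.
Qed.

Lemma elem_mulE i j c x a l : i != j ->
  SLval (elem i j c * x)%g a l = SLval x a l + (a == i)%:R * c * SLval x j l.
Proof.
move=> ij; rewrite SLvalM elemE // mulmxDl mul1mx -scalemxAl !mxE; congr (_ + _).
rewrite (bigD1 j) //= big1 => [|m /negPf mj]; last by rewrite !mxE mj andbF mul0r.
by rewrite !mxE eqxx andbT addr0 mulrA [c * _]mulrC.
Qed.

(** Row operations with the pivot x_mm = 1; the term i = m of the list is an
    identity matrix, as [elem m m c] is. *)
Lemma clear_column (m : I) x (s : seq I) : SLval x m m = 1 -> uniq s ->
  exists y x', [/\ generated (size s) y, x = (y * x')%g & forall i l,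
    SLval x' i l = SLval x i l -
      ((i \in s) && (i != m))%:R * (SLval x i m * SLval x m l)].
Proof.
move=> xm; elim: s => [|i s IH] /=.
  move=> _; exists 1%g, x; rewrite mul1g; split=> // i l.
  by rewrite mul0r subr0.
move=> /andP[is_ /IH [y [x' [Hy xE x'E]]]].
exists (y * elem i m (SLval x i m))%g, (elem i m (- SLval x i m) * x')%g.
split.
- by rewrite -addn1; apply: generatedM (generated_elem _ _ _).
- by rewrite mulgA -[(_ * elem _ _ _ * elem _ _ _)%g]mulgA elemD subrr elem0 mulg1.
move=> a l; have [im|im] := eqVneq i m.
  rewrite im elem_diag mul1g x'E in_cons.
  by have [->|am] := eqVneq a m; rewrite ?eqxx ?andbF // (negPf am).
rewrite elem_mulE // !x'E eqxx andbF mul0r subr0 in_cons.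
have [->|ai] := eqVneq a i; last by rewrite !mul0r addr0.
by rewrite (negPf is_) im mul0r subr0 !mul1r mulNr.
Qed.

Definition unit_columns (m : nat) x :=
  forall i l : I, (l < m)%N -> SLval x i l = (i == l)%:R.

Lemma unit_columns_elem m x (i j : I) c : (m <= j)%N -> unit_columns m x ->
  unit_columns m (elem i j c * x)%g.
Proof.
move=> mj Ux a l lm; have [->|ij] := eqVneq i j.
  by rewrite elem_diag mul1g Ux.
rewrite elem_mulE // !Ux //; have -> : j == l = false.
  by apply/negP => /eqP jl; move: mj; rewrite jl leqNgt lm.
by rewrite mulr0 addr0.
Qed.

(** Otherwise column m would be a combination of the first m basis vectors, which
    are the first m columns. *)
Lemma unit_columns_nonzero (m : I) x : unit_columns m x ->
  exists2 i : I, (m <= i)%N & SLval x i m != 0.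
Proof.
move=> Ux; apply: contrapT => H.
have x0 (i : I) : (m <= i)%N -> SLval x i m = 0.
  by move=> mi; apply/eqP/negPn/negP => xi; apply: H; exists i.
pose w : 'cV[F]_k.+3 :=
  \col_l (if l == m then 1 else if (l < m)%N then - SLval x l m else 0).
have xw : SLval x *m w = 0.
  apply/matrixP => i j; rewrite ord1 !mxE (bigD1 m) //= mxE eqxx mulr1.
  have [im|mi] := ltnP i m; last first.
    rewrite x0 // add0r big1 // => l lm; rewrite mxE (negPf lm).
    case: ltnP => lm'; last by rewrite mulr0.
    rewrite Ux //; case: eqP => [il|_]; last by rewrite mul0r.
    by move: mi; rewrite il leqNgt lm'.
  have im' : i != m by apply: contraTneq im => ->; rewrite ltnn.
  rewrite (bigD1 i) //= big1 => [|l /andP[lm li]].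
    by rewrite mxE (negPf im') im (Ux i i) // eqxx mul1r addr0 subrr.
  rewrite mxE (negPf lm); case: ltnP => lm'; last by rewrite mulr0.
  by rewrite Ux // eq_sym (negPf li) mul0r.
have w0 : w = 0 by rewrite -[w](mulKmx (SL_unitmx x)) xw mulmx0.
by move: w0 => /matrixP/(_ m 0)/eqP; rewrite !mxE eqxx oner_eq0.
Qed.

Lemma unit_columns_last x : unit_columns k.+2 x -> SLval x ord_max ord_max = 1.
Proof.
move=> Ux; have T : is_trig_mx (SLval x)^T.
  apply/is_trig_mxP => i j ij; rewrite mxE Ux.
    by case: eqP => // ji; move: ij; rewrite ji ltnn.
  by apply: leq_trans ij _; rewrite -ltnS ltn_ord.
rewrite -(SL_det x) -det_tr (det_trig T) (bigD1 ord_max) //= mxE big1 ?mulr1 //.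
move=> i im; rewrite mxE Ux ?eqxx // ltn_neqAle -ltnS ltn_ord andbT.
exact: im.
Qed.

(** A nonzero entry below the pivot lets one row operation set the pivot to 1; if
    there is none, the pivot is added to the next row first. In the last column
    the pivot is the determinant. *)
Lemma unit_pivot (m : I) x : unit_columns m x -> exists y x',
  [/\ generated 2 y, x = (y * x')%g, unit_columns m x' & SLval x' m m = 1].
Proof.
move=> Ux.
have pivot x0 (i : I) : unit_columns m x0 -> (m < i)%N -> SLval x0 i m != 0 ->
    exists y x', [/\ generated 1 y, x0 = (y * x')%g, unit_columns m x' &
      SLval x' m m = 1].
  move=> Ux0 mi xi; pose c := (1 - SLval x0 m m) / SLval x0 i m.
  exists (elem m i (- c)), (elem m i c * x0)%g; split.
  - exact: generated_elem.
  - by rewrite mulgA elemD addNr elem0 mul1g.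
  - by apply: unit_columns_elem => //; apply: ltnW.
  rewrite elem_mulE; last by apply: contraTneq mi => ->; rewrite ltnn.
  by rewrite eqxx mul1r /c divfK // addrC subrK.
have [mM|mM] := eqVneq m ord_max.
  exists 1%g, x; rewrite mul1g; split=> //; first exact: generated1.
  by rewrite mM unit_columns_last //; move: Ux; rewrite mM.
have mlt : (m < k.+2)%N by rewrite ltn_neqAle -ltnS ltn_ord andbT.
have [[i /andP[mi xi]]|H] := pselect (exists i : I, (m < i)%N && (SLval x i m != 0)).
  have [y [x' [Hy xE Ux' x'm]]] := pivot x i Ux mi xi.
  exists (1 * y)%g, x'; rewrite mul1g; split=> //.
  by rewrite -[y]mul1g; apply: (@generatedM 1 1) => //; apply: generated1.
have x0 (i : I) : (m < i)%N -> SLval x i m = 0.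
  by move=> mi; apply/eqP/negPn/negP => xi; apply: H; exists i; rewrite mi.
have [i mi xi] := unit_columns_nonzero Ux.
have im : i = m.
  apply/val_inj/eqP; rewrite eqn_leq mi andbT leqNgt.
  by apply/negP => /x0 E; rewrite E eqxx in xi.
rewrite im in xi; pose m' : I := Ordinal (mlt : m.+1 < k.+3)%N.
have m'm : m' != m by rewrite -val_eqE /= neq_ltn ltnSn orbT.
have [||y [x' [Hy xE Ux' x'm]]] := pivot (elem m' m 1 * x)%g m' _ (ltnSn _).
- exact: unit_columns_elem.
- by rewrite elem_mulE // eqxx !mul1r x0 ?ltnSn // add0r.
exists (elem m' m (- 1) * y)%g, x'; split=> //.
  by apply: (@generatedM 1 1) => //; apply: generated_elem.
by rewrite -mulgA -xE mulgA elemD addNr elem0 mul1g.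
Qed.

(** The columns are cleared from left to right; row operations whose source is at
    or below the pivot do not affect the columns already cleared. *)
Theorem bounded_generation : exists ps, forall x, elem_products ps x.
Proof.
suff H d : (d <= k.+3)%N -> exists N, forall x,
    unit_columns (k.+3 - d) x -> generated N x.
  have [N HN] := H k.+3 (leqnn _); exists (positions N) => x; apply: HN.
  by rewrite subnn.
elim: d => [|d IH] dk.
  exists 0%N => x; rewrite subn0 => Ux; suff -> : x = 1%g by apply: generated1.
  by apply: SL_inj; apply/matrixP => i j; rewrite Ux // mxE.
have [N HN] := IH (ltnW dk); exists ((2 + k.+3) + N)%N => x Ux.
have mk : (k.+3 - d.+1 < k.+3)%N by rewrite ltn_subrL.
pose m : I := Ordinal mk.
have [y [x1 [Hy -> Ux1 x1m]]] := @unit_pivot m x Ux.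
have [z [x2 [Hz x1E x2E]]] := clear_column x1m (enum_uniq I).
rewrite x1E mulgA; apply: generatedM.
  by apply: generatedM => //; rewrite -[k.+3]size_enum_ord.
apply: HN => i l; rewrite subSn // ltnS x2E mem_enum /= leq_eqVlt.
case/orP => [lm|lm].
  have -> : l = m by apply/val_inj/eqP.
  rewrite x1m mulr1; have [->|im] := eqVneq i m.
    by rewrite mul0r subr0 x1m.
  by rewrite mul1r subrr.
rewrite (Ux1 i l) // (Ux1 m l) //; have -> : m == l = false.
  by apply/negP => /eqP ml; move: lm; rewrite -ml ltnn.
by rewrite !mulr0 subr0.
Qed.

End BoundedGeneration.

(** * Definability in groups and rings *)

Section GroupTerms.
Variables (gT : groupType) (V : Type).
Local Notation tdef := (@term_definable group_sig (group_structure gT) V).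
Implicit Types f g : (V -> gT) -> gT.

Lemma term_definable_mulg f g :
  tdef f -> tdef g -> tdef (fun v => (f v * g v)%g).
Proof.
move=> [s Hs] [t Ht].
exists (@App group_sig V GMul (fun i => if i == ord0 then s else t)) => v /=.
by rewrite Hs Ht.
Qed.

Lemma term_definable_invg f : tdef f -> tdef (fun v => (f v)^-1)%g.
Proof. by move=> [s Hs]; exists (@App group_sig V GInv (fun=> s)) => v /=; rewrite Hs. Qed.

Lemma term_definable_one : tdef (fun=> 1%g).
Proof.
by exists (@App group_sig V GOne (fun i : 'I_0 => False_rect _ (notF (valP i)))).
Qed.

Lemma term_definable_commg f g :
  tdef f -> tdef g -> tdef (fun v => [~ f v, g v]%g).
Proof.
move=> df dg; rewrite /commg /conjg.
apply: term_definable_mulg (term_definable_invg df) _.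
apply: term_definable_mulg (term_definable_invg dg) _.
exact: term_definable_mulg.
Qed.

Lemma term_definable_expg f m : tdef f -> tdef (fun v => f v ^+ m)%g.
Proof.
move=> df; elim: m => [|m [t Ht]].
  by have [t Ht] := term_definable_one; exists t => v; rewrite Ht expg0.
have [s Hs] := term_definable_mulg df (ex_intro _ t Ht).
by exists s => v; rewrite Hs expgS.
Qed.

End GroupTerms.

Section RingTerms.
Variables (R : pzRingType) (V : Type).
Local Notation tdef := (@term_definable ring_sig (ring_structure R) V).
Implicit Types f g : (V -> R) -> R.

Lemma term_definable_add f g : tdef f -> tdef g -> tdef (fun v => f v + g v).
Proof.
move=> [s Hs] [t Ht].
exists (@App ring_sig V RAdd (fun i => if i == ord0 then s else t)) => v /=.
by rewrite Hs Ht.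
Qed.

Lemma term_definable_mul f g : tdef f -> tdef g -> tdef (fun v => f v * g v).
Proof.
move=> [s Hs] [t Ht].
exists (@App ring_sig V RMul (fun i => if i == ord0 then s else t)) => v /=.
by rewrite Hs Ht.
Qed.

Lemma term_definable_opp f : tdef f -> tdef (fun v => - f v).
Proof. by move=> [s Hs]; exists (@App ring_sig V ROpp (fun=> s)) => v /=; rewrite Hs. Qed.

Lemma term_definable_natr m : tdef (fun=> m%:R).
Proof.
pose c (f : ring_fsym) (E : @farity ring_sig f = 0%N) : term ring_sig V :=
  @App ring_sig V f (fun i => False_rect _ (notF (valP (cast_ord E i)))).
elim: m => [|m IH]; first by exists (c RZero erefl).
have d1 : tdef (fun=> 1) by exists (c ROne erefl).
by have [t Ht] := term_definable_add d1 IH; exists t => v; rewrite Ht mulrS.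
Qed.

Lemma term_definable_sum (J : Type) (r : seq J) (f : J -> (V -> R) -> R) :
  (forall j, tdef (f j)) -> tdef (fun v => \sum_(j <- r) f j v).
Proof.
move=> df; elim: r => [|j r IH].
  by have [t Ht] := term_definable_natr 0; exists t => v; rewrite Ht big_nil.
by have [t Ht] := term_definable_add (df j) IH; exists t => v; rewrite Ht big_cons.
Qed.

Lemma term_definable_prod (J : Type) (r : seq J) (f : J -> (V -> R) -> R) :
  (forall j, tdef (f j)) -> tdef (fun v => \prod_(j <- r) f j v).
Proof.
move=> df; elim: r => [|j r IH].
  by have [t Ht] := term_definable_natr 1; exists t => v; rewrite Ht big_nil.
by have [t Ht] := term_definable_mul (df j) IH; exists t => v; rewrite Ht big_cons.
Qed.

End RingTerms.

(** * The group of matrices in the field *)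

Section Codes.
Variables (F : fieldType) (k : nat).
Local Notation I := 'I_k.+3.
Local Notation G := (SL k.+3 F).
Local Notation GS := (group_structure G).
Local Notation FS := (ring_structure F).
Local Notation d := #|{: I * I}|.
Local Notation o2 := (i2 k).

Definition rk (i j : I) : 'I_d := enum_rank (i, j).

Lemma eq_rk T (f g : 'I_d -> T) : (forall i j, f (rk i j) = g (rk i j)) -> f = g.
Proof. by move=> E; apply/funext => a; rewrite -(enum_valK a); case: (enum_val a). Qed.

Definition tuple_matrix (z : 'I_d -> F) : 'M[F]_k.+3 := \matrix_(i, j) z (rk i j).

Definition entries (A : 'M[F]_k.+3) (a : 'I_d) : F := A (enum_val a).1 (enum_val a).2.

Lemma entries_rk A i j : entries A (rk i j) = A i j.
Proof. by rewrite /entries enum_rankK. Qed.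

Lemma tuple_matrixK z : entries (tuple_matrix z) = z.
Proof. by apply: eq_rk => i j; rewrite entries_rk mxE. Qed.

Lemma entriesK A : tuple_matrix (entries A) = A.
Proof. by apply/matrixP => i j; rewrite mxE entries_rk. Qed.

Definition matrix_definable V (A : (V -> F) -> 'M[F]_k.+3) : Prop :=
  forall i j, @term_definable ring_sig FS V (fun v => A v i j).

Lemma matrix_definable_tuple V (t : 'I_d -> V) :
  matrix_definable (fun v => tuple_matrix (fun a => v (t a))).
Proof.
move=> i j; apply: (@term_definable_ext _ FS) (@term_definable_var _ FS _ (t (rk i j))).
by move=> v; rewrite mxE.
Qed.

Lemma matrix_definable_mul V (A B : (V -> F) -> 'M[F]_k.+3) :
  matrix_definable A -> matrix_definable B ->
  matrix_definable (fun v => A v *m B v).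
Proof.
move=> dA dB i j; have := @term_definable_sum F V _ (index_enum _) (fun l v => A v i l * B v l j).
move=> H; apply: (@term_definable_ext _ FS) (H _) => [v|l]; first by rewrite mxE.
exact: term_definable_mul.
Qed.

Lemma matrix_definable1 V : matrix_definable (fun _ : V -> F => 1%:M).
Proof.
move=> i j; apply: (@term_definable_ext _ FS) (term_definable_natr F V (i == j)).
by move=> v; rewrite mxE.
Qed.

Lemma matrix_definable_eq V (A B : (V -> F) -> 'M[F]_k.+3) :
  matrix_definable A -> matrix_definable B ->
  @definable ring_sig FS V (fun v => A v = B v).
Proof.
move=> dA dB; apply: (@definable_ext _ FS _ (fun v => forall i j, A v i j = B v i j)).
  by move=> v; split=> [/matrixP|->].
apply: definable_forall_fin => i; apply: definable_forall_fin => j.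
exact: definable_eq.
Qed.

Lemma term_definable_det V (A : (V -> F) -> 'M[F]_k.+3) :
  matrix_definable A -> @term_definable ring_sig FS V (fun v => \det (A v)).
Proof.
move=> dA; rewrite /determinant; apply: term_definable_sum => s.
apply: term_definable_mul; last by apply: term_definable_prod => i; apply: dA.
case: (perm.odd_perm s); rewrite ?expr1 ?expr0; last exact: (term_definable_natr F V 1).
by apply: (term_definable_opp (term_definable_natr F V 1)).
Qed.

Definition matrix_dom (v : 'I_d + 'I_0 -> F) : Prop :=
  \det (tuple_matrix (fun a => v (inl a))) = 1.

Lemma matrix_dom_definable : @definable ring_sig FS _ matrix_dom.
Proof.
apply: (@definable_eq ring_sig FS); last exact: (term_definable_natr F _ 1).
exact/term_definable_det/matrix_definable_tuple.
Qed.

Definition matrix_graph (f : fsym group_sig) :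
    ('I_(farity f) * 'I_d + 'I_d + 'I_0 -> F) -> Prop :=
  match f with
  | GMul => fun v => tuple_matrix (fun a => v (inl (inl (ord0, a)))) *m
      tuple_matrix (fun a => v (inl (inl (ord_max, a)))) =
      tuple_matrix (fun a => v (inl (inr a)))
  | GInv => fun v => tuple_matrix (fun a => v (inl (inl (ord0, a)))) *m
      tuple_matrix (fun a => v (inl (inr a))) = 1%:M
  | GOne => fun v => tuple_matrix (fun a => v (inl (inr a))) = 1%:M
  end.

Lemma matrix_graph_definable f : @definable ring_sig FS _ (@matrix_graph f).
Proof.
case: f => /=; apply: matrix_definable_eq; try exact: matrix_definable1;
  try exact: matrix_definable_tuple;
  by apply: matrix_definable_mul; apply: matrix_definable_tuple.
Qed.

Definition matrix_code : code group_sig ring_sig :=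
  definable_code matrix_dom_definable matrix_graph_definable (fun r => match r with end).

Lemma matrix_code_presents (p : 'I_0 -> F) :
  @presents _ _ matrix_code GS FS p (fun x : G => entries (SLval x)).
Proof.
apply: definable_code_presents.
- by move=> x y E; apply: SL_inj; rewrite -[LHS]entriesK E entriesK.
- move=> z; rewrite /matrix_dom /=; split=> [dz|[x ->]].
    by exists (mkSL (tuple_matrix z)); rewrite mkSLK // tuple_matrixK.
  by rewrite entriesK SL_det.
- have E (x y : G) : SLval x = SLval y <-> x = y by split=> [/SL_inj|->].
  case=> xs b; rewrite /vflat /= !entriesK.
  + by rewrite -SLvalM E; split=> [->|->].
  + rewrite -SLvalM -(SLval1 F k.+3) E; split=> [xb|->]; last by rewrite mulgV.
    by apply: (mulgI (xs ord0)); rewrite xb mulgV.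
  + by rewrite -(SLval1 F k.+3) E.
Qed.

End Codes.

(** * The field in the group *)

Section FieldInGroup.
Variables (F : fieldType) (k : nat).
Local Notation I := 'I_k.+3.
Local Notation G := (SL k.+3 F).
Local Notation GS := (group_structure G).
Local Notation FS := (ring_structure F).
Local Notation d := #|{: I * I}|.
Local Notation o2 := (i2 k).
Implicit Types (q : I -> I -> G) (x y z s t : G).

(** The root subgroup {e_02(c)}. Commutators remove the central factors that
    appear in centralizers. *)
Definition line q x : Prop := exists y,
  (forall j, j != 0 -> y * q 0 j = q 0 j * y)%g /\ x = [~ y, q 1%R o2]%g.

(** e_01(a) and e_12(b) are obtained from e_02(a) and e_02(b) by commutation with
    the frame, and their commutator is e_02(ab). *)
Definition line_mul q s t : G := [~ [~ s, q o2 1%R], [~ q 1%R 0, t]]%g.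

(** The element e_ij(c) as a word in the frame and t = e_02(c). *)
Definition line_elem q (i j : I) t : G :=
  if i == j then 1%g
  else if i == 0 then (if j == o2 then t else [~ t, q o2 j]%g)
  else if i == o2 then
    (if j == 0 then [~ q o2 1%R, [~ [~ q 1%R 0, t], q o2 0]]%g
     else [~ q o2 0, [~ t, q o2 j]]%g)
  else if j == o2 then [~ q i 0, t]%g
  else [~ [~ q i 0, t], q o2 j]%g.

Local Notation std := (fun i j : I => elem i j 1 : G).

(** An element centralizing the first row of the frame is a scalar times 1 + e_0 f,
    and its commutator with e_12(1) is e_02(f_1). *)
Lemma line_std x : line std x <-> exists c, x = elem 0 o2 c.
Proof.
split=> [[y [/first_row_centralizer [c [f [yE fe cn]]] ->]]|[c ->]]; last first.
  exists (elem 0 1%R c); split; first by move=> j j0; apply: elem_comm; rewrite // eq_sym.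
  by rewrite elem_commutator ?mulr1.
exists (f 0 1); apply: (mulgI (elem 1%R o2 1%R * y)%g); rewrite -commgC.
apply: SL_inj; rewrite !SLvalM yE !elemE // !scale1r -scalemxAl -!scalemxAr -scalemxAl.
congr (_ *: _); rewrite add1_commutator_sqzero.
- congr (_ *m (1%:M + _)).
  have -> : delta_mx 1 o2 = delta_mx 1 0 *m delta_mx (0 : 'I_1) o2 :> 'M[F]_k.+3.
    by rewrite mul_delta_mx.
  rewrite dyad_mul mul_delta_mx; congr (_ *: _).
  by rewrite /pairing -colE mxE.
- by rewrite mulmxA -[_ *m f *m _]mulmxA fe mulmx0 mul0mx.
- by rewrite mulmxA mul_delta_mx_0 ?mul0mx.
Qed.

Lemma line_mul_std a b : line_mul std (elem 0 o2 a) (elem 0 o2 b) = elem 0 o2 (a * b).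
Proof. by rewrite /line_mul !elem_commutator // mulr1 mul1r. Qed.

Lemma line_elem_std (i j : I) c : line_elem std i j (elem 0 o2 c) = elem i j c.
Proof.
rewrite /line_elem; have [->|ij] := eqVneq i j; first by rewrite elem_diag.
have [i0|i0] := eqVneq i 0.
  have [->|j2] := eqVneq j o2; first by rewrite i0.
  by rewrite i0 in ij *; rewrite elem_commutator ?mulr1 // eq_sym.
have [i2|i2] := eqVneq i o2.
  have [->|j0] := eqVneq j 0.
    by rewrite i2 !elem_commutator // ?mulr1 ?mul1r.
  rewrite i2 in ij *.
  by rewrite !elem_commutator ?mulr1 ?mul1r // 1?eq_sym.
have [->|j2] := eqVneq j o2.
  by rewrite elem_commutator ?mul1r.
by rewrite !elem_commutator ?mulr1 ?mul1r // eq_sym.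
Qed.

Section Definability.
Variables (V : Type).
Local Notation tdef := (@term_definable group_sig GS V).
Variables (q : (V -> G) -> I -> I -> G).
Hypothesis dq : forall i j, tdef (fun v => q v i j).

Lemma line_mul_definable (s t : (V -> G) -> G) :
  tdef s -> tdef t -> tdef (fun v => line_mul (q v) (s v) (t v)).
Proof. by move=> ds dt; do !apply: term_definable_commg. Qed.

Lemma line_elem_definable i j (t : (V -> G) -> G) :
  tdef t -> tdef (fun v => line_elem (q v) i j (t v)).
Proof.
move=> dt; rewrite /line_elem; case: (i == j) (i == 0) (i == o2) (j == 0) (j == o2).
  by move=> *; apply: term_definable_one.
by move=> [] [] [] [] //; do !apply: term_definable_commg.
Qed.

End Definability.

Lemma line_definable V (q' : (V -> G) -> I -> I -> G) (t : (V -> G) -> G) :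
  (forall i j, @term_definable group_sig GS V (fun v => q' v i j)) ->
  @term_definable group_sig GS V t ->
  @definable group_sig GS V (fun v => line (q' v) (t v)).
Proof.
move=> dq dt; apply: (@definable_ex group_sig GS).
have dq' i j := term_definable_weaken (dq i j).
have dt' := term_definable_weaken dt.
have dy := @term_definable_var _ GS _ (@None V).
apply: definable_and.
  apply: definable_forall_fin => j.
  apply: definable_imp; first exact: definable_const.
  by apply: (@definable_eq group_sig GS); apply: term_definable_mulg => //; apply: dq'.
by apply: (@definable_eq group_sig GS) => //; apply: term_definable_commg => //; apply: dq'.
Qed.

(** States that x is X times a product of elementary matrices along ps and that
    z consists of the copies in the line of the entries of x, if Z consists of
    those of X: a column operation on X is applied to Z in the line. *)
Fixpoint product_entries (ps : seq (I * I)) q (X : G) (Z : I -> I -> G)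
    (x : G) (z : I -> I -> G) : Prop :=
  match ps with
  | [::] => X = x /\ forall a b, z a b = Z a b
  | p :: ps => exists t, line q t /\
      product_entries ps q (X * line_elem q p.1 p.2 t)%g
        (fun a b => if (b == p.2) && (p.1 != p.2)
           then (Z a b * line_mul q (Z a p.1) t)%g else Z a b) x z
  end.

Lemma product_entries_definable V ps (q' : (V -> G) -> I -> I -> G)
    (X : (V -> G) -> G) (Z : (V -> G) -> I -> I -> G) (x : (V -> G) -> G)
    (z : (V -> G) -> I -> I -> G) :
  (forall i j, @term_definable group_sig GS V (fun v => q' v i j)) ->
  @term_definable group_sig GS V X ->
  (forall i j, @term_definable group_sig GS V (fun v => Z v i j)) ->
  @term_definable group_sig GS V x ->
  (forall i j, @term_definable group_sig GS V (fun v => z v i j)) ->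
  @definable group_sig GS V
    (fun v => product_entries ps (q' v) (X v) (Z v) (x v) (z v)).
Proof.
elim: ps V q' X Z x z => [|p ps IH] V q' X Z x z dq dX dZ dx dz /=.
  apply: definable_and; first exact: (@definable_eq group_sig GS).
  apply: definable_forall_fin => a; apply: definable_forall_fin => b.
  exact: (@definable_eq group_sig GS).
apply: (@definable_ex group_sig GS).
have dq' i j := term_definable_weaken (dq i j).
have dZ' i j := term_definable_weaken (dZ i j).
have dz' i j := term_definable_weaken (dz i j).
have dt := @term_definable_var _ GS _ (@None V).
apply: definable_and; first by apply: line_definable.
apply: (IH _ (fun w => q' (fun u => w (Some u)))
  (fun w => X (fun u => w (Some u)) *
     line_elem (q' (fun u => w (Some u))) p.1 p.2 (w None))%g
  (fun w a b => if (b == p.2) && (p.1 != p.2)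
     then (Z (fun u => w (Some u)) a b *
       line_mul (q' (fun u => w (Some u))) (Z (fun u => w (Some u)) a p.1) (w None))%g
     else Z (fun u => w (Some u)) a b)
  (fun w => x (fun u => w (Some u))) (fun w => z (fun u => w (Some u)))) => //.
- apply: term_definable_mulg; first exact: term_definable_weaken dX.
  exact: line_elem_definable.
- move=> a b; case: (_ && _); last exact: dZ'.
  by apply: term_definable_mulg => //; apply: line_mul_definable.
- exact: term_definable_weaken dx.
Qed.

Lemma elem_mulrE (X : G) (i j : I) c a b :
  SLval (X * elem i j c)%g a b =
  SLval X a b + ((b == j) && (i != j))%:R * (SLval X a i * c).
Proof.
have [->|ij] := eqVneq i j; first by rewrite elem_diag mulg1 andbF mul0r addr0.
rewrite andbT SLvalM elemE // mulmxDr mulmx1 -scalemxAr !mxE; congr (_ + _).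
rewrite (bigD1 i) //= big1 => [|m /negPf mi]; last by rewrite !mxE mi mulr0.
by rewrite !mxE eqxx /= addr0 mulrCA [c * _]mulrC [RHS]mulrCA.
Qed.

Lemma product_entries_std ps (X x : G) (z : I -> I -> G) :
  product_entries ps std X (fun a b => elem 0 o2 (SLval X a b)) x z <->
  exists y, [/\ elem_products ps y, x = (X * y)%g &
    forall a b, z a b = elem 0 o2 (SLval x a b)].
Proof.
elim: ps X => [|p ps IH] X /=.
  split=> [[<- zE]|[y [-> -> zE]]]; first by exists 1%g; rewrite mulg1; split.
  by rewrite mulg1 in zE *; split.
have ZE c : (fun a b : I => if (b == p.2) && (p.1 != p.2)
      then (elem 0 o2 (SLval X a b) *
            line_mul std (elem 0 o2 (SLval X a p.1)) (elem 0 o2 c))%g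
      else elem 0 o2 (SLval X a b)) =
    (fun a b => elem 0 o2 (SLval (X * elem p.1 p.2 c)%g a b)).
  apply/funext => a; apply/funext => b; rewrite elem_mulrE line_mul_std elemD.
  by case: ifP => _; rewrite ?mul1r // mul0r addr0.
split=> [[t [/line_std [c ->]]]|[y [[c [y' [Hy' ->]]] xE zE]]].
  rewrite ZE line_elem_std => /IH [y [Hy -> zE]].
  by exists (elem p.1 p.2 c * y)%g; rewrite mulgA; split=> //; exists c, y.
exists (elem 0 o2 c); split; first by apply/line_std; exists c.
rewrite ZE line_elem_std; by apply/IH; exists y'; rewrite -mulgA.
Qed.

(** The conditions that depend on the characteristic quantify over all primes,
    but at most one prime is concerned. *)
Lemma frame_definable V (r : I -> I -> V) :
  @definable group_sig GS V (fun v => frame (fun i j => v (r i j))).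
Proof.
pose q (v : V -> G) i j := v (r i j).
have dq i j : @term_definable group_sig GS V (fun v => q v i j).
  exact: (@term_definable_var _ GS).
have dconj V' (s t : (V' -> G) -> G) :
    @term_definable group_sig GS V' s -> @term_definable group_sig GS V' t ->
    @definable group_sig GS V' (fun v => exists g, s v * g = g * t v)%g.
  move=> ds dt; apply: (@definable_ex group_sig GS).
  have dg := @term_definable_var _ GS _ (@None V').
  by apply: (@definable_eq group_sig GS); apply: term_definable_mulg => //;
    apply: term_definable_weaken.
have dcentral V' (s : (V' -> G) -> G) : @term_definable group_sig GS V' s ->
    @definable group_sig GS V' (fun v => central (s v)).
  move=> ds; apply: (@definable_all group_sig GS).
  have dg := @term_definable_var _ GS _ (@None V').
  by apply: (@definable_eq group_sig GS); apply: term_definable_mulg => //;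
    apply: term_definable_weaken.
have d_diag : @definable group_sig GS V (fun v => forall i, q v i i = 1%g).
  apply: definable_forall_fin => i; apply: (@definable_eq group_sig GS) => //.
  exact: term_definable_one.
have d_neq1 : @definable group_sig GS V (fun v => q v 0 1 <> 1%g).
  apply: definable_not; apply: (@definable_eq group_sig GS) => //.
  exact: term_definable_one.
have d_conj : @definable group_sig GS V (fun v =>
    forall i j, i != j -> exists g, (q v i j * g = g * q v 0 1%R)%g).
  apply: definable_forall_fin => i; apply: definable_forall_fin => j.
  by apply: definable_imp; [apply: definable_const | apply: dconj].
have d_comm : @definable group_sig GS V (fun v =>
    forall i j l m, i != j -> l != m -> j != l -> i != m ->
    (q v i j * q v l m = q v l m * q v i j)%g).
  do 4![apply: definable_forall_fin => ?].
  do 4![apply: definable_imp; first exact: definable_const].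
  by apply: (@definable_eq group_sig GS); apply: term_definable_mulg.
have d_commutator : @definable group_sig GS V (fun v =>
    forall i j l, i != j -> j != l -> i != l -> [~ q v i j, q v j l]%g = q v i l).
  do 3![apply: definable_forall_fin => ?].
  do 3![apply: definable_imp; first exact: definable_const].
  by apply: (@definable_eq group_sig GS) => //; apply: term_definable_commg.
have d_centralizer : @definable group_sig GS V (fun v =>
    forall y, (forall j, j != 0 -> y * q v 0 j = q v 0 j * y)%g ->
    central y \/ exists z g, central z /\ (y * g = z * (g * q v 0 1%R))%g).
  apply: (@definable_all group_sig GS); apply: definable_imp.
    apply: definable_forall_fin => j.
    apply: definable_imp; first exact: definable_const.
    by apply: (@definable_eq group_sig GS); apply: term_definable_mulg;
      apply: (@term_definable_var _ GS).
  apply: definable_or; first by apply: dcentral; apply: (@term_definable_var _ GS).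
  do 2!apply: (@definable_ex group_sig GS).
  apply: definable_and; first by apply: dcentral; apply: (@term_definable_var _ GS).
  by apply: (@definable_eq group_sig GS); do !apply: term_definable_mulg;
    apply: (@term_definable_var _ GS).
have d_pchar : @definable group_sig GS V (fun v =>
    forall p, p \in [pchar F] -> (q v 0 1%R ^+ p = 1)%g).
  have [[p pF]|noP] := pselect (exists p, p \in [pchar F]).
    apply: (@definable_ext _ GS _ (fun v => q v 0 1%R ^+ p = 1)%g).
      move=> v; split=> [H p'|H]; last exact: H.
      by rewrite (pcharf_eq pF) inE => /eqP ->.
    apply: (@definable_eq group_sig GS); last exact: term_definable_one.
    exact: term_definable_expg.
  apply: (@definable_ext _ GS _ (fun v => True)); last exact: definable_const.
  by move=> v; split=> // _ p pF; case: noP; exists p.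
have d_char0 : @definable group_sig GS V (fun v =>
    [pchar F] =i pred0 -> forall m : I,
    exists g, (q v 0 1%R ^+ m.+2 * g = g * q v 0 1%R)%g).
  apply: definable_imp; first exact: definable_const.
  apply: definable_forall_fin => m; apply: dconj => //.
  exact: term_definable_expg.
have D := definable_and d_diag (definable_and d_neq1 (definable_and d_conj
  (definable_and d_comm (definable_and d_commutator (definable_and d_centralizer
  (definable_and d_pchar d_char0)))))).
apply: definable_ext D => v; split; first by move=> [? [? [? [? [? [? [? ?]]]]]]]; split.
by case=> *; do !split.
Qed.

Definition frame_of T (p : 'I_d -> T) (i j : I) : T := p (rk i j).

Definition line_dom (v : 'I_1 + 'I_d -> G) : Prop :=
  line (frame_of (fun a => v (inr a))) (v (inl ord0)).

Lemma line_dom_definable : @definable group_sig GS _ line_dom.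
Proof.
apply: line_definable => [i j|]; exact: (@term_definable_var _ GS).
Qed.

Definition line_graph (f : fsym ring_sig) :
    ('I_(farity f) * 'I_1 + 'I_1 + 'I_d -> G) -> Prop :=
  match f with
  | RAdd => fun v => v (inl (inr ord0)) =
      (v (inl (inl (ord0, ord0))) * v (inl (inl (ord_max, ord0))))%g
  | ROpp => fun v => v (inl (inr ord0)) = (v (inl (inl (ord0, ord0))))^-1%g
  | RMul => fun v => v (inl (inr ord0)) =
      line_mul (frame_of (fun a => v (inr a)))
        (v (inl (inl (ord0, ord0)))) (v (inl (inl (ord_max, ord0))))
  | RZero => fun v => v (inl (inr ord0)) = 1%g
  | ROne => fun v => v (inl (inr ord0)) = v (inr (rk 0 o2))
  end.

Lemma line_graph_definable f : @definable group_sig GS _ (@line_graph f).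
Proof.
case: f => /=; apply: (@definable_eq group_sig GS);
  try exact: (@term_definable_var _ GS).
- by apply: term_definable_mulg; apply: (@term_definable_var _ GS).
- by apply: term_definable_invg; apply: (@term_definable_var _ GS).
- by apply: line_mul_definable => [i j||]; apply: (@term_definable_var _ GS).
- exact: term_definable_one.
Qed.

Definition line_code : code ring_sig group_sig :=
  definable_code line_dom_definable line_graph_definable (fun r => match r with end).

Definition std_frame (a : 'I_d) : G := elem (enum_val a).1 (enum_val a).2 1.

Lemma std_frame_rk i j : std_frame (rk i j) = elem i j 1.
Proof. by rewrite /std_frame enum_rankK. Qed.

Lemma frame_of_std : frame_of std_frame = std.
Proof. by apply/funext => i; apply/funext => j; apply: std_frame_rk. Qed.

Lemma line_code_presents :
  @presents _ _ line_code FS GS std_frame (fun c _ => elem 0 o2 c).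
Proof.
apply: definable_code_presents.
- by move=> a b /(congr1 (@^~ ord0)) /elem_inj; apply.
- move=> x; rewrite /line_dom /= frame_of_std line_std; split=> -[c E]; exists c.
    by apply/funext => i; rewrite ord1 -E.
  by rewrite E.
- have E (a b : F) : elem 0 o2 a = elem 0 o2 b :> G <-> a = b.
    by split=> [/elem_inj->|->].
  case=> xs b; rewrite /vflat /=.
  + by rewrite elemD E.
  + by rewrite elemV E.
  + by rewrite frame_of_std line_mul_std E.
  + by rewrite -(elem0 F 0 o2) E.
  + by rewrite std_frame_rk E.
Qed.

End FieldInGroup.

(** * Bi-interpretation *)

Section Biinterpretation.
Variables (F : fieldType) (k : nat).
Local Notation I := 'I_k.+3.
Local Notation G := (SL k.+3 F).
Local Notation GS := (group_structure G).
Local Notation FS := (ring_structure F).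
Local Notation d := #|{: I * I}|.
Local Notation o2 := (i2 k).

Lemma frame_presents (p : 'I_d -> G) : frame (frame_of p) ->
  exists a a' : G -> G,
    [/\ @isomorphism _ GS GS a, @isomorphism _ GS GS a', cancel a' a,
      p = (fun b => a (@std_frame F k b)) &
      @presents _ _ (line_code F k) FS GS p (fun c _ => a (elem 0 o2 c)) /\
      forall c, SLval (a (elem 0 o2 c)) = 1%:M + c *: (SLval (p (rk 0 o2)) - 1%:M)].
Proof.
move=> /frame_automorphism [a ai [aE aL]]; have [[a' aK a'K] _ _] := ai.
have pE : p = (fun b => a (@std_frame F k b)).
  by apply: eq_rk => i j; rewrite std_frame_rk aE.
exists a, a'; split=> //; first exact: (isomorphism_inv ai aK a'K).
split; last exact: aL.
by rewrite pE; apply: (presents_transport ai (line_code_presents F k)).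
Qed.

Definition group_theta ps
    (v : unit + 'I_d * 'I_1 + 'I_0 * 'I_1 + 'I_d -> G) : Prop :=
  product_entries ps (frame_of (fun a => v (inr a))) 1%g
    (fun i j => if i == j then v (inr (rk 0 o2)) else 1%g)
    (v (inl (inl (inl tt)))) (fun i j => v (inl (inl (inr (rk i j, ord0))))).

Lemma group_theta_definable ps : @definable _ GS _ (group_theta ps).
Proof.
apply: product_entries_definable => [i j||i j||i j];
  try exact: (@term_definable_var _ GS); first exact: term_definable_one.
case: (i == j); last exact: term_definable_one.
exact: (@term_definable_var _ GS).
Qed.

(** The entries of 1 + c(q_02 - 1). *)
Definition field_theta
    (v : unit + 'I_1 * 'I_d + 'I_d * 'I_d + 'I_0 -> F) : Prop :=
  forall i j, v (inl (inl (inr (ord0, rk i j)))) = (i == j)%:R +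
    v (inl (inl (inl tt))) * (v (inl (inr (rk 0 o2, rk i j))) - (i == j)%:R).

Lemma field_theta_definable : @definable _ FS _ field_theta.
Proof.
apply: definable_forall_fin => i; apply: definable_forall_fin => j.
apply: (@definable_eq _ FS); first exact: (@term_definable_var _ FS).
apply: term_definable_add; first exact: term_definable_natr.
apply: term_definable_mul; first exact: (@term_definable_var _ FS).
apply: term_definable_add; first exact: (@term_definable_var _ FS).
exact/term_definable_opp/term_definable_natr.
Qed.

Theorem SL_biinterpretable : regularly_biinterpretable GS FS.
Proof.
have [phi phiP] := @definable_const _ FS 'I_0 True.
have [psi psiP] := frame_definable F (@rk k).
have [ps psG] := bounded_generation F k.
have [thA thAP] := group_theta_definable ps.
have [thB thBP] := field_theta_definable.
exists (matrix_code F k), phi, (line_code F k), psi; split.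
- split=> [|p _]; first by exists (fun i : 'I_0 => 0); apply/phiP.
  exact: (presents_interpreted (matrix_code_presents k p)).
- split=> [|p /psiP Q].
    exists (@std_frame F k); apply/psiP.
    have := frame_elem F k; rewrite -(frame_of_std F k); exact.
  have [a [_ [_ _ _ _ [H _]]]] := frame_presents Q.
  exact: presents_interpreted H.
- exists thA; apply: presents_self_isomorphism => q /psiP Q.
  have [a [a' [ai a'i a'K qE [H _]]]] := frame_presents Q.
  exists (fun (c : FS) (_ : 'I_1) => a (elem 0 o2 c)) => // p _.
  exists (fun (x : GS) => entries (SLval (a' x))).
    exact: (presents_precomp a'i (matrix_code_presents k p)).
  move=> x z; have aI : injective a' := can_inj a'K.
  have aK : cancel a a'.
    have [[b ab ba] _ _] := ai; move=> y; apply: (can_inj ab).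
    by rewrite a'K.
  rewrite (sat_isomorphism a'i) thAP /group_theta /vflat /=.
  have -> : frame_of (fun b => a' (q b)) = fun i j => elem i j 1.
    by rewrite -frame_of_std; congr frame_of; apply/funext => b; rewrite qE aK.
  have -> : a' (q (rk 0 o2)) = elem 0 o2 1 by rewrite qE aK std_frame_rk.
  have -> : (fun i j : I => if i == j then elem 0 o2 1 else 1%g) =
      (fun i j : I => elem 0 o2 (SLval (1%g : G) i j)).
    apply/funext => i; apply/funext => j; rewrite SLval1 mxE.
    by case: eqP => _; rewrite ?elem0.
  rewrite product_entries_std; split=> [[y [_ _ zE]]|->].
    apply: eq_rk => i j; apply/funext => b; rewrite ord1 entries_rk.
    by apply: aI; rewrite zE aK.
  exists (a' x); rewrite mul1g; split=> // i j.
  by rewrite entries_rk aK.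
- exists thB; apply: presents_self_isomorphism => q _.
  exists (fun (x : GS) => entries (SLval x)); first exact: matrix_code_presents.
  move=> p /psiP Q; have [a [_ [_ _ _ _ [H aL]]]] := frame_presents Q.
  exists (fun (c : FS) (_ : 'I_1) => a (elem 0 o2 c)) => // c z.
  have E i j : entries (SLval (a (elem 0 o2 c))) (rk i j) =
      (i == j)%:R + c * (entries (SLval (p (rk 0 o2))) (rk i j) - (i == j)%:R).
    by rewrite !entries_rk aL !mxE.
  rewrite thBP /field_theta /vflat /=; split=> [zE|-> //].
  apply/funext => b; rewrite ord1; apply: eq_rk => i j.
  by rewrite zE -E.
Qed.

End Biinterpretation.

Local Close Scope ring_scope.

Theorem theoremA1 (F : fieldType) (n : nat) (hn : 3 <= n) :
  regularly_biinterpretable (group_structure (SL n F)) (ring_structure F).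
Proof. by case: n hn => [|[|[|k]]] // _; apply: SL_biinterpretable. Qed.
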